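(* Let $R$ and $Q_R$ be as in the context and let $q\in Q_R$. Then for every $\xi\in\mathbb{R}$ the complex quaternion $F_q(\xi):=\sum_{k\in\mathbb{Z}}\widehat{B_q}(\xi+2\pi k)$ is invertible in $\mathbb{H}_\mathbb{C}$; the function $\widehat{L_q}(\xi):=\widehat{B_q}(\xi)F_q(\xi)^{-1}$ lies in $L^1(\mathbb{R},\mathbb{H}_\mathbb{C})\cap L^2(\mathbb{R},\mathbb{H}_\mathbb{C})$; and the function $$L_q(x):=\frac1{2\pi}\int_\mathbb{R}\widehat{L_q}(\xi)e^{i\xi x}d\xi,\qquad x\in\mathbb{R},$$ satisfies $L_q(m)=\delta_{m,0}$ for all $m\in\mathbb{Z}$.
   Context: $\mathbb{H}_\mathbb{R}$ denotes the real quaternions $a+v_1e_1+v_2e_2+v_3e_3$ with $e_1^2=e_2^2=e_3^2=-1$, $e_1e_2=e_3$, $e_2e_3=e_1$, $e_3e_1=e_2$; $\mathbb{H}_\mathbb{C}$ the complex quaternions (complex coefficients, $i$ commuting with every $e_j$). For $q=a+v$, $v=\sum v_je_j$, $|v|=(\sum v_j^2)^{1/2}$. Quaternionic power: for $z\in\mathbb{C}\setminus\{0\}$, $p=b+u\in\mathbb{H}_\mathbb{R}$, $u\ne0$: $z^p:=z^b[\cos(|u|\log z)+\frac{u}{|u|}\sin(|u|\log z)]$ (principal $\log$, $z^b=e^{b\log z}$). $\Xi(\xi):=\frac{1-e^{-i\xi}}{i\xi}$, $\Xi(0):=1$; $\widehat{B_q}(\xi):=\Xi(\xi)^q$ and $B_q$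 is its inverse Fourier transform (Fourier transform $\hat f(\xi)=\int f(x)e^{-i\xi x}dx$). Classical Hurwitz zeta: $\zeta(s,a)=\sum_{k\ge0}(a+k)^{-s}$. Standing assumption: $R\subset\{w\in\mathbb{C}:\mathrm{Re}\,w>1\}$ is a set with $\overline R=R$ such that for every $w\in R$ and every $\alpha\in(0,1)$, $\zeta(w,\alpha)+e^{-i\pi w}\zeta(w,1-\alpha)\neq0$. Define $Q_R:=\{q=a+v\in\mathbb{H}_\mathbb{R}: v\ne0,\ a+i|v|\in R\}$. *)

(* Defs.v *)
From Stdlib Require Import Reals Lra List ZArith.
Open Scope R_scope.

Definition CC : Type := (R * R)%type.
Definition Cre (z : CC) : R := fst z.
Definition Cim (z : CC) : R := snd z.
Definition RtoC (x : R) : CC := (x, 0).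
Definition C0 : CC := (0, 0).
Definition C1 : CC := (1, 0).
Definition Ci : CC := (0, 1).
Definition Cadd (z w : CC) : CC := (Cre z + Cre w, Cim z + Cim w).
Definition Copp (z : CC) : CC := (- Cre z, - Cim z).
Definition Csub (z w : CC) : CC := Cadd z (Copp w).
Definition Cmul (z w : CC) : CC :=
  (Cre z * Cre w - Cim z * Cim w, Cre z * Cim w + Cim z * Cre w).
Definition Cconj (z : CC) : CC := (Cre z, - Cim z).
Definition Cnorm2 (z : CC) : R := Cre z * Cre z + Cim z * Cim z.
Definition Cnorm (z : CC) : R := sqrt (Cnorm2 z).
Definition Cinv (z : CC) : CC := (Cre z / Cnorm2 z, - Cim z / Cnorm2 z).
Definition Cdiv (z w : CC) : CC := Cmul z (Cinv w).
Definition Cscal (r : R) (z : CC) : CC := (r * Cre z, r * Cim z).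

Definition Cexp (z : CC) : CC := (exp (Cre z) * cos (Cim z), exp (Cre z) * sin (Cim z)).
Definition Ccos (z : CC) : CC := (cos (Cre z) * cosh (Cim z), - (sin (Cre z) * sinh (Cim z))).
Definition Csin (z : CC) : CC := (sin (Cre z) * cosh (Cim z), cos (Cre z) * sinh (Cim z)).

(* principal argument in (-PI, PI] (0 at the origin) and principal logarithm *)
Definition Carg (z : CC) : R :=
  let x := Cre z in let y := Cim z in
  if Rlt_dec 0 x then atan (y / x)
  else if Rlt_dec x 0 then
    (if Rle_dec 0 y then atan (y / x) + PI else atan (y / x) - PI)
  else if Rlt_dec 0 y then PI / 2
  else if Rlt_dec y 0 then - (PI / 2) else 0.
Definition Clog (z : CC) : CC := (ln (Cnorm z), Carg z).

Definition Cpow_real (z : CC) (b : R) : CC := Cexp (Cscal b (Clog z)).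

(* real quaternion  a + v1 e1 + v2 e2 + v3 e3 *)
Record HR : Type := mkHR { hr0 : R; hr1 : R; hr2 : R; hr3 : R }.
Definition HRvnorm (q : HR) : R := sqrt (hr1 q ^ 2 + hr2 q ^ 2 + hr3 q ^ 2).
Definition HRvec_nonzero (q : HR) : Prop := ~ (hr1 q = 0 /\ hr2 q = 0 /\ hr3 q = 0).

(* complex quaternion  c0 + c1 e1 + c2 e2 + c3 e3, ci complex; i central *)
Record HC : Type := mkHC { hc0 : CC; hc1 : CC; hc2 : CC; hc3 : CC }.
Definition HC0 : HC := mkHC C0 C0 C0 C0.
Definition HC1 : HC := mkHC C1 C0 C0 C0.
(* product with e1^2=e2^2=e3^2=-1, e1e2=e3, e2e3=e1, e3e1=e2 *)
Definition HCmul (x y : HC) : HC :=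
  let a0 := hc0 x in let a1 := hc1 x in let a2 := hc2 x in let a3 := hc3 x in
  let b0 := hc0 y in let b1 := hc1 y in let b2 := hc2 y in let b3 := hc3 y in
  mkHC
    (Csub (Csub (Csub (Cmul a0 b0) (Cmul a1 b1)) (Cmul a2 b2)) (Cmul a3 b3))
    (Cadd (Cadd (Cmul a0 b1) (Cmul a1 b0)) (Csub (Cmul a2 b3) (Cmul a3 b2)))
    (Cadd (Cadd (Cmul a0 b2) (Cmul a2 b0)) (Csub (Cmul a3 b1) (Cmul a1 b3)))
    (Cadd (Cadd (Cmul a0 b3) (Cmul a3 b0)) (Csub (Cmul a1 b2) (Cmul a2 b1))).
Definition HCcscal (c : CC) (x : HC) : HC :=
  mkHC (Cmul c (hc0 x)) (Cmul c (hc1 x)) (Cmul c (hc2 x)) (Cmul c (hc3 x)).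
Definition HCrscal (r : R) (x : HC) : HC := HCcscal (RtoC r) x.

Definition HCproj : list (HC -> R) :=
  (fun x => Cre (hc0 x)) :: (fun x => Cim (hc0 x)) ::
  (fun x => Cre (hc1 x)) :: (fun x => Cim (hc1 x)) ::
  (fun x => Cre (hc2 x)) :: (fun x => Cim (hc2 x)) ::
  (fun x => Cre (hc3 x)) :: (fun x => Cim (hc3 x)) :: nil.

(* z^p = z^b [cos(|u| log z) + u/|u| sin(|u| log z)] for z <> 0, u <> 0;
   convention: 0^p := 0 (continuous extension, Re p > 0); if u = 0, z^p := z^b *)
Definition qpow (z : CC) (p : HR) : HC :=
  if Req_EM_T (Cnorm2 z) 0 then HC0 else
  let b := hr0 p in let nu := HRvnorm p in
  let zb := Cpow_real z b in
  if Req_EM_T nu 0 then mkHC zb C0 C0 C0 else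
  let L := Cscal nu (Clog z) in
  let s := Cmul zb (Csin L) in
  mkHC (Cmul zb (Ccos L))
       (Cscal (hr1 p / nu) s) (Cscal (hr2 p / nu) s) (Cscal (hr3 p / nu) s).

Definition Xi (xi : R) : CC :=
  if Req_EM_T xi 0 then C1
  else Cdiv (Csub C1 (Cexp (Cscal (- xi) Ci))) (Cscal xi Ci).

Definition Bhat (q : HR) (xi : R) : HC := qpow (Xi xi) q.

Definition hurwitz_term (w : CC) (a : R) (k : nat) : CC :=
  Cexp (Cmul (Copp w) (RtoC (ln (a + INR k)))).
Definition is_hurwitz (w : CC) (a : R) (z : CC) : Prop :=
  Un_cv (fun N => sum_f_R0 (fun k => Cre (hurwitz_term w a k)) N) (Cre z) /\
  Un_cv (fun N => sum_f_R0 (fun k => Cim (hurwitz_term w a k)) N) (Cim z).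

Definition admissible_R (Rs : CC -> Prop) : Prop :=
  (forall w, Rs w -> 1 < Cre w) /\
  (forall w, Rs w <-> Rs (Cconj w)) /\
  (forall w, Rs w -> forall alpha, 0 < alpha < 1 ->
     forall z1 z2, is_hurwitz w alpha z1 -> is_hurwitz w (1 - alpha) z2 ->
     Cadd z1 (Cmul (Cexp (Cmul (Cscal (- PI) Ci) w)) z2) <> C0).

Definition in_Q_R (Rs : CC -> Prop) (q : HR) : Prop :=
  HRvec_nonzero q /\ Rs (hr0 q, HRvnorm q).

Definition HC_Zsum (g : Z -> HC) (v : HC) : Prop :=
  forall c, In c HCproj ->
    Un_cv (fun N => sum_f_R0 (fun i => c (g (Z.of_nat i - Z.of_nat N)%Z)) (2 * N)) (c v).

Definition is_RInt (g : R -> R) (a b l : R) : Prop :=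
  exists pr : Riemann_integrable g a b, RiemannInt pr = l.
Definition loc_RInt (g : R -> R) : Prop :=
  forall a b, a <= b -> exists l, is_RInt g a b l.
Definition L1R (g : R -> R) : Prop :=
  loc_RInt g /\ exists M, forall a b l, a <= b ->
    is_RInt (fun x => Rabs (g x)) a b l -> l <= M.
Definition L2R (g : R -> R) : Prop :=
  loc_RInt g /\ exists M, forall a b l, a <= b ->
    is_RInt (fun x => (g x) ^ 2) a b l -> l <= M.
Definition L1HC (f : R -> HC) : Prop := forall c, In c HCproj -> L1R (fun x => c (f x)).
Definition L2HC (f : R -> HC) : Prop := forall c, In c HCproj -> L2R (fun x => c (f x)).

Definition is_improper_int (g : R -> R) (l : R) : Prop :=
  loc_RInt g /\
  forall eps, 0 < eps -> exists T0, forall T l', T0 <= T ->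
    is_RInt g (- T) T l' -> Rabs (l' - l) < eps.
Definition HC_improper_int (f : R -> HC) (v : HC) : Prop :=
  forall c, In c HCproj -> is_improper_int (fun x => c (f x)) (c v).

(* Main.v *)
From Stdlib Require Import Reals List ZArith Lra Lia FunctionalExtensionality.
From Coquelicot Require Import Rcomplements Rbar Hierarchy Continuity Derive RInt
  RInt_analysis Lim_seq Series.
(* Imported last: its [is_RInt] must shadow Coquelicot's. *)
Require Import Defs.
Open Scope R_scope.

(** For a unit vector [n], the elements [(1 + i n)/2] and [(1 - i n)/2] are complementary
    idempotents on which [n] acts as [-i] and [i]; hence [z^q] has the components [z^w] with
    [w = a - i|v|] and [w = a + i|v|], and everything reduces to the scalar functions [Xi^w].
    On [2 pi k < x < 2 pi (k + 1)], with [x = h + 2 pi k] and [alpha = h / (2 pi)], one has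
    [log Xi(x) = log (sin (h/2) / pi) - i h/2 - log |k + alpha|], plus [i pi] when [k < 0].
    Summing over [k] gives a nonzero factor times
    [zeta(w, alpha) + e^(i pi w) zeta(w, 1 - alpha)], so the periodization [P] of [Xi^w]
    has no zero.  Since [|Xi(x)^w| <= C (1 + |x|)^(- Re w)] and [Re w > 1], the series converge
    locally uniformly, [P] is continuous and [Xi^w / P] inherits the decay.  Cutting the
    integral of [e^(i m x) Xi^w / P] into periods and summing first leaves the integral of
    [e^(i m x)] over one period. *)

(** * Periodization of decaying functions *)

(** The claims concern Riemann integrals and partial sums, so every exchange of limits is made
    through uniform convergence against one majorant series, [sum (1 + k)^(- a)] with
    [a = Re w > 1]. Its tail bounds truncation errors uniformly over a period; this yields both the
    continuity of [P], hence the boundedness of [1 / P] by compactness of a period, and termwise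
    integration. The delicate point is the cut of the principal logarithm. [Xi] meets the real axis
    only in the values 0 and 1, so it never reaches the negative half-line, and [Xi^w] is continuous
    wherever [Xi] is nonzero. At the zeros [2 pi k], [k <> 0], the logarithm gives nothing, and a
    bound [|z^w| <= K |z|], available because [Re w > 1], takes its place. The Hurwitz condition
    covers only [0 < alpha < 1]. The remaining points [x = 2 pi k] are separate: there a single term
    of the periodization survives, and it equals 1. *)

Definition pterm (a : R) (k : nat) : R := Rpower (1 + INR k) (- a).

Lemma pterm_pos a k : 0 < pterm a k.
Proof. apply exp_pos. Qed.

Lemma Rpower_neg_le a x y : 0 <= a -> 0 < x <= y -> Rpower y (- a) <= Rpower x (- a).
Proof.
intros Ha [Hx Hxy]. rewrite !Rpower_Ropp.
apply Rinv_le_contravar; [apply exp_pos | apply Rle_Rpower_l; lra].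
Qed.

(** Integral comparison: by the mean value theorem the bracket equals [(a - 1) * Rpower c (- a)] for
    some [c] below [1 + INR (S k)]. Summed over [k] the right side telescopes, which bounds the
    partial sums. *)
Lemma pterm_telescope a k : 1 < a ->
  pterm a (S k) <= / (a - 1) * (Rpower (1 + INR k) (1 - a) - Rpower (1 + INR (S k)) (1 - a)).
Proof.
intros Ha.
assert (Hk : 0 <= INR k) by apply pos_INR.
destruct (MVT_cor2 (fun x => Rpower x (1 - a)) (fun x => (1 - a) * Rpower x (1 - a - 1))
   (1 + INR k) (1 + INR (S k))) as [c [Hc1 Hc2]].
- rewrite S_INR; lra.
- intros c Hc. apply derivable_pt_lim_power; lra.
- rewrite S_INR in *. unfold pterm. rewrite S_INR.
  replace (Rpower (1 + INR k) (1 - a) - Rpower (1 + (INR k + 1)) (1 - a))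
    with ((a - 1) * Rpower c (- a)).
  2:{ replace (- a) with (1 - a - 1) by ring. 
      replace (1 + (INR k + 1) - (1 + INR k)) with 1 in Hc1 by ring. lra. }
  rewrite <- Rmult_assoc, Rinv_l, Rmult_1_l by lra.
  apply Rpower_neg_le; lra.
Qed.

Lemma ex_series_pterm a : 1 < a -> ex_series (pterm a).
Proof.
intros Ha. apply ex_series_Reals_1.
assert (Hg : Un_growing (sum_f_R0 (pterm a))).
{ intros n. simpl. pose proof (pterm_pos a (S n)). lra. }
destruct (growing_cv (sum_f_R0 (pterm a)) Hg) as [l Hl].
- exists (1 + / (a - 1)). intros y [n ->].
  assert (Hi : 0 < / (a - 1)) by (apply Rinv_0_lt_compat; lra).
  assert (H : sum_f_R0 (pterm a) n <= 1 + / (a - 1) * (1 - Rpower (1 + INR n) (1 - a))).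
  { induction n as [|n IH].
    - simpl. unfold pterm. simpl. rewrite Rplus_0_r.
      unfold Rpower. rewrite ln_1, !Rmult_0_r, exp_0. lra.
    - rewrite tech5. pose proof (pterm_telescope a n Ha). nra. }
  pose proof (exp_pos ((1 - a) * ln (1 + INR n))) as Hp. unfold Rpower in H.
  nra.
- exists l. intros eps He. apply Hl, He.
Qed.

(** The tail of the majorant series: one sequence, independent of the point, that controls the
    truncation error of all dominated sums. *)
Definition prest (a : R) (N : nat) : R := Series (pterm a) - sum_f_R0 (pterm a) N.

Lemma sum_pterm_cv a : 1 < a -> Un_cv (sum_f_R0 (pterm a)) (Series (pterm a)).
Proof.
intros Ha. apply is_lim_seq_Reals.
apply (is_lim_seq_ext (sum_n (pterm a))); [intros n; apply sum_n_Reals|].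
exact (Series_correct _ (ex_series_pterm a Ha)).
Qed.

Lemma sum_pterm_le a N : 1 < a -> sum_f_R0 (pterm a) N <= Series (pterm a).
Proof.
intros Ha. apply growing_ineq; [|apply sum_pterm_cv, Ha].
intros n. simpl. pose proof (pterm_pos a (S n)). lra.
Qed.

Lemma prest_cv a : 1 < a -> Un_cv (prest a) 0.
Proof.
intros Ha eps He. destruct (sum_pterm_cv a Ha eps He) as [N HN].
exists N. intros n Hn. specialize (HN n Hn). unfold Rdist, prest in *.
replace (Series (pterm a) - sum_f_R0 (pterm a) n - 0)
  with (- (sum_f_R0 (pterm a) n - Series (pterm a))) by ring.
rewrite Rabs_Ropp. exact HN.
Qed.

Lemma pterm_cv a : 1 < a -> Un_cv (pterm a) 0.
Proof. intros Ha. apply is_lim_seq_Reals, ex_series_lim_0, ex_series_pterm, Ha. Qed.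

(** * Symmetric sums over the integers *)

Definition zsum (g : Z -> R) (N : nat) : R :=
  sum_f_R0 (fun i => g (Z.of_nat i - Z.of_nat N)%Z) (2 * N).

Lemma zsum_0 g : zsum g 0 = g 0%Z.
Proof. reflexivity. Qed.

Lemma zsum_S g N :
  zsum g (S N) = zsum g N + g (Z.of_nat (S N)) + g (- Z.of_nat (S N))%Z.
Proof.
unfold zsum. replace (2 * S N)%nat with (S (S (2 * N))) by lia.
rewrite tech5, decomp_sum by lia.
replace (Z.of_nat 0 - Z.of_nat (S N))%Z with (- Z.of_nat (S N))%Z by lia.
replace (Z.of_nat (S (S (2 * N))) - Z.of_nat (S N))%Z with (Z.of_nat (S N)) by lia.
rewrite (sum_eq _ (fun i => g (Z.of_nat i - Z.of_nat N)%Z));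
  [change (pred (S (2 * N))) with (2 * N)%nat; ring|].
intros i _. f_equal. lia.
Qed.

Lemma zsum_ext g h N : (forall k, g k = h k) -> zsum g N = zsum h N.
Proof. intros H. apply sum_eq. intros; apply H. Qed.

Lemma zsum_plus g h N : zsum (fun k => g k + h k) N = zsum g N + zsum h N.
Proof. apply sum_plus. Qed.

Lemma zsum_scal c g N : zsum (fun k => c * g k) N = c * zsum g N.
Proof. unfold zsum. rewrite scal_sum. apply sum_eq. intros; ring. Qed.

Definition zdom (a K : R) (g : Z -> R) : Prop :=
  forall k, Rabs (g k) <= K * pterm a (Z.abs_nat k).

Lemma zsum_step a K g N : zdom a K g ->
  Rabs (g (Z.of_nat (S N)) + g (- Z.of_nat (S N))%Z) <= 2 * K * pterm a (S N).
Proof.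
intros H. eapply Rle_trans; [apply Rabs_triang|].
pose proof (H (Z.of_nat (S N))) as H1. pose proof (H (- Z.of_nat (S N))%Z) as H2.
rewrite Zabs2Nat.id in H1.
replace (Z.abs_nat (- Z.of_nat (S N))) with (S N) in H2 by lia. lra.
Qed.

Lemma zsum_cauchy a K g N n : zdom a K g ->
  Rabs (zsum g (N + n) - zsum g N)
    <= 2 * K * (sum_f_R0 (pterm a) (N + n) - sum_f_R0 (pterm a) N).
Proof.
intros H. induction n as [|n IH].
- rewrite Nat.add_0_r, !Rminus_diag, Rabs_R0. lra.
- rewrite Nat.add_succ_r, zsum_S, tech5.
  pose proof (zsum_step a K g (N + n) H) as Hs.
  replace (zsum g (N + n) + g (Z.of_nat (S (N + n))) + g (- Z.of_nat (S (N + n)))%Z - zsum g N)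
   with ((zsum g (N + n) - zsum g N) + (g (Z.of_nat (S (N + n))) + g (- Z.of_nat (S (N + n)))%Z))
   by ring.
  eapply Rle_trans; [apply Rabs_triang|]. lra.
Qed.

Lemma zdom_nonneg a K g : zdom a K g -> 0 <= K.
Proof.
intros H. pose proof (H 0%Z) as H0. pose proof (Rabs_pos (g 0%Z)).
pose proof (pterm_pos a (Z.abs_nat 0)). nra.
Qed.

Lemma zsum_cauchy_rest a K g N n : 1 < a -> zdom a K g ->
  Rabs (zsum g (N + n) - zsum g N) <= 2 * K * prest a N.
Proof.
intros Ha H. eapply Rle_trans; [apply zsum_cauchy, H|].
pose proof (sum_pterm_le a (N + n) Ha). pose proof (zdom_nonneg _ _ _ H).
unfold prest. nra.
Qed.

Lemma zsum_ex_lim a K g : 1 < a -> zdom a K g -> exists s, Un_cv (zsum g) s.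
Proof.
intros Ha H.
assert (Hc : Cauchy_crit (zsum g)).
{ intros eps He. pose proof (zdom_nonneg _ _ _ H) as HK.
  (* The factor 4 accounts for two errors [2 * K * prest a N], one for each of [n] and [m]; the
     [+ 1] keeps the quotient meaningful when [K = 0]. *)
  destruct (prest_cv a Ha (eps / (4 * K + 1))) as [N HN].
  { apply Rdiv_lt_0_compat; lra. }
  exists N. intros n m Hn Hm. specialize (HN N (le_n N)).
  assert (Hb : 4 * K * prest a N < eps).
  { unfold Rdist in HN. rewrite Rminus_0_r in HN.
    pose proof (Rle_abs (prest a N)).
    assert (Hq : eps / (4 * K + 1) * (4 * K + 1) = eps) by (field; lra).
    assert (0 < eps / (4 * K + 1)) by (apply Rdiv_lt_0_compat; lra). nra. }
  replace n with (N + (n - N))%nat by lia. replace m with (N + (m - N))%nat by lia.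
  pose proof (zsum_cauchy_rest a K g N (n - N) Ha H) as H1.
  pose proof (zsum_cauchy_rest a K g N (m - N) Ha H) as H2.
  unfold Rdist. apply Rabs_le_between in H1. apply Rabs_le_between in H2. apply Rabs_def1; lra. }
destruct (Rcomplete.R_complete _ Hc) as [s Hs]. exists s. exact Hs.
Qed.

Lemma Un_cv_const c : Un_cv (fun _ => c) c.
Proof. intros eps He. exists 0%nat. intros. unfold Rdist. rewrite Rminus_diag, Rabs_R0. lra. Qed.

Lemma zsum_rest a K g s N : 1 < a -> zdom a K g -> Un_cv (zsum g) s ->
  Rabs (zsum g N - s) <= 2 * K * prest a N.
Proof.
intros Ha H Hs. apply le_epsilon. intros eps He.
destruct (Hs eps He) as [M HM].
specialize (HM (N + M)%nat ltac:(lia)). unfold Rdist in HM.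
pose proof (zsum_cauchy_rest a K g N M Ha H) as H1.
apply Rabs_def2 in HM. apply Rabs_le_between in H1. apply Rabs_le. lra.
Qed.

Lemma zsum_bound a K g N : 1 < a -> zdom a K g ->
  Rabs (zsum g N) <= 2 * K * Series (pterm a).
Proof.
intros Ha H. pose proof (zdom_nonneg _ _ _ H) as HK.
pose proof (zsum_cauchy a K g 0 N H) as H1. rewrite zsum_0, Nat.add_0_l in H1.
pose proof (H 0%Z) as H0. change (Z.abs_nat 0) with 0%nat in H0.
change (sum_f_R0 (pterm a) 0) with (pterm a 0) in H1.
pose proof (sum_pterm_le a N Ha) as H2. pose proof (pterm_pos a 0).
assert (K * sum_f_R0 (pterm a) N <= K * Series (pterm a)) by (apply Rmult_le_compat_l; assumption).
assert (0 <= K * pterm a 0) by (apply Rmult_le_pos; lra).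
apply Rabs_le_between in H0. apply Rabs_le_between in H1. apply Rabs_le. lra.
Qed.

(** * Decay and periodization *)

Definition decays (a C : R) (f : R -> R) : Prop :=
  forall x, Rabs (f x) <= C * Rpower (1 + Rabs x) (- a).

Lemma decays_nonneg a C f : decays a C f -> 0 <= C.
Proof.
intros H. pose proof (H 0) as H0. pose proof (Rabs_pos (f 0)).
pose proof (exp_pos (- a * ln (1 + Rabs 0))). unfold Rpower in H0. nra.
Qed.

(** Peetre's inequality: [1 + |k| <= (1 + |x|) (1 + |x + 2 pi k|)], since [2 pi >= 1]. Raised to the
    power [a] and inverted, it trades decay of a function for decay in the index [k]. *)
Lemma decay_shift a x k : 0 <= a ->
  Rpower (1 + Rabs (x + 2 * PI * IZR k)) (- a)
    <= Rpower (1 + Rabs x) a * pterm a (Z.abs_nat k).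
Proof.
intros Ha. unfold pterm.
pose proof (Rabs_pos x) as Hx. pose proof (Rabs_pos (x + 2 * PI * IZR k)) as Hy.
assert (Hk : INR (Z.abs_nat k) = Rabs (IZR k)).
{ rewrite INR_IZR_INZ, Zabs2Nat.id_abs. apply abs_IZR. }
rewrite Hk. pose proof (Rabs_pos (IZR k)) as Hk0.
assert (Hle : Rabs (IZR k) <= Rabs x + Rabs (x + 2 * PI * IZR k)).
{ pose proof (Rabs_triang (x + 2 * PI * IZR k) (- x)) as Ht.
  rewrite Rabs_Ropp in Ht.
  replace (x + 2 * PI * IZR k + - x) with (2 * PI * IZR k) in Ht by ring.
  rewrite Rabs_mult, (Rabs_right (2 * PI)) in Ht by (pose proof PI_RGT_0; lra).
  pose proof PI2_1. nra. }
assert (Hm : Rpower (1 + Rabs (IZR k)) a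
  <= Rpower (1 + Rabs x) a * Rpower (1 + Rabs (x + 2 * PI * IZR k)) a).
{ rewrite Rpower_mult_distr by lra. apply Rle_Rpower_l; [exact Ha|]. nra. }
rewrite !Rpower_Ropp.
set (A := Rpower (1 + Rabs (IZR k)) a) in *. set (B := Rpower (1 + Rabs x) a) in *.
set (D := Rpower (1 + Rabs (x + 2 * PI * IZR k)) a) in *.
assert (0 < A) by apply exp_pos. assert (0 < B) by apply exp_pos.
assert (0 < D) by apply exp_pos.
apply Rmult_le_reg_r with (A * D); [nra|].
replace (/ D * (A * D)) with A by (field; lra).
replace (B * / A * (A * D)) with (B * D) by (field; lra). exact Hm.
Qed.

Lemma decays_zdom a C f x : 0 <= a -> decays a C f ->
  zdom a (C * Rpower (1 + Rabs x) a) (fun k => f (x + 2 * PI * IZR k)).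
Proof.
intros Ha H k. eapply Rle_trans; [apply H|]. rewrite (Rmult_assoc C).
apply Rmult_le_compat_l; [apply (decays_nonneg _ _ _ H)|]. apply decay_shift, Ha.
Qed.

Lemma decays_zdom_le a C f x B : 0 <= a -> decays a C f -> Rabs x <= B ->
  zdom a (C * Rpower (1 + B) a) (fun k => f (x + 2 * PI * IZR k)).
Proof.
intros Ha H Hx k. eapply Rle_trans; [apply (decays_zdom a C f x Ha H)|].
apply Rmult_le_compat_r; [left; apply pterm_pos|].
apply Rmult_le_compat_l; [apply (decays_nonneg _ _ _ H)|].
apply Rle_Rpower_l; [exact Ha|]. pose proof (Rabs_pos x). lra.
Qed.

Lemma continuous_shift (f : R -> R) c x :
  (forall y, continuous f y) -> continuous (fun x => f (x + c)) x.
Proof.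
intros H. apply (continuous_comp (fun x => x + c) f); [|apply H].
apply (continuous_plus (V := R_NormedModule) (fun x => x) (fun _ => c));
  [apply continuous_id|apply continuous_const].
Qed.

Lemma continuous_zsum (f : Z -> R -> R) N x :
  (forall k y, continuous (f k) y) -> continuous (fun x => zsum (fun k => f k x) N) x.
Proof.
intros H. induction N as [|N IH].
- apply (H (0%Z)).
- apply (continuous_ext (fun x => zsum (fun k => f k x) N + f (Z.of_nat (S N)) x
     + f (- Z.of_nat (S N))%Z x)).
  + intros y. rewrite zsum_S. reflexivity.
  + apply (continuous_plus (V := R_NormedModule)
       (fun x => zsum (fun k => f k x) N + f (Z.of_nat (S N)) x)); [|apply H].
    apply (continuous_plus (V := R_NormedModule)); [exact IH|apply H].
Qed.

Definition periodization (f F : R -> R) : Prop :=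
  forall x, Un_cv (zsum (fun k => f (x + 2 * PI * IZR k))) (F x).

Lemma periodization_ex a C f : 1 < a -> decays a C f -> exists F, periodization f F.
Proof.
intros Ha H.
(* [Lim_seq] is total and agrees with the limit whenever there is one, so the function is obtained
   without choosing a limit at each point. *)
exists (fun x => real (Lim_seq (zsum (fun k => f (x + 2 * PI * IZR k))))).
intros x. destruct (zsum_ex_lim a _ _ Ha (decays_zdom a C f x ltac:(lra) H)) as [s Hs].
apply is_lim_seq_Reals in Hs. rewrite (is_lim_seq_unique _ _ Hs).
apply is_lim_seq_Reals, Hs.
Qed.

Lemma periodization_continuous a C f F x : 1 < a -> decays a C f ->
  (forall y, continuous f y) -> periodization f F -> continuous F x.
Proof.
intros Ha H Hc HF. apply continuity_pt_filterlim.
(* A domination constant valid on the whole ball of radius 1 about [x], where [|y| <= |x| + 1]; this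
   makes the convergence uniform there. *)
set (K := C * Rpower (1 + (Rabs x + 1)) a).
assert (HK : 0 <= K).
{ apply Rmult_le_pos; [apply (decays_nonneg _ _ _ H)|]. left; apply exp_pos. }
apply (CVU_continuity (fun N x => zsum (fun k => f (x + 2 * PI * IZR k)) N) F x
   (mkposreal 1 Rlt_0_1)).
- intros eps He.
  destruct (prest_cv a Ha (eps / (2 * K + 1))) as [N HN].
  { apply Rdiv_lt_0_compat; lra. }
  exists N. intros n y Hn Hy. specialize (HN n Hn). unfold Boule in Hy. simpl in Hy.
  rewrite Rabs_minus_sym.
  eapply Rle_lt_trans; [apply (zsum_rest a K _ _ _ Ha)|].
  + apply decays_zdom_le; [lra|exact H|].
    pose proof (Rabs_triang (y - x) x) as Ht. replace (y - x + x) with y in Ht by ring. lra.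
  + apply HF.
  + unfold Rdist in HN. rewrite Rminus_0_r in HN.
    pose proof (Rle_abs (prest a n)).
    assert (Hq : eps / (2 * K + 1) * (2 * K + 1) = eps) by (field; lra).
    assert (0 < eps / (2 * K + 1)) by (apply Rdiv_lt_0_compat; lra). nra.
- intros n y _. apply continuity_pt_filterlim.
  apply (continuous_zsum (fun k x => f (x + 2 * PI * IZR k))).
  intros k z. apply continuous_shift, Hc.
- unfold Boule. simpl. rewrite Rminus_diag, Rabs_R0. lra.
Qed.

Lemma zsum_shift g N :
  zsum (fun k => g (k + 1)%Z) N = zsum g N + g (Z.of_nat (S N)) - g (- Z.of_nat N)%Z.
Proof.
induction N as [|N IH].
- rewrite !zsum_0. simpl. ring.
- rewrite !zsum_S, IH.
  replace (Z.of_nat (S N) + 1)%Z with (Z.of_nat (S (S N))) by lia.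
  replace (- Z.of_nat (S N) + 1)%Z with (- Z.of_nat N)%Z by lia. ring.
Qed.

Lemma zdom_cv a K (g : Z -> R) (u : nat -> Z) : 1 < a -> zdom a K g ->
  (forall n, (n <= Z.abs_nat (u n))%nat) -> Un_cv (fun n => g (u n)) 0.
Proof.
intros Ha H Hu eps He. pose proof (zdom_nonneg _ _ _ H) as HK.
destruct (pterm_cv a Ha (eps / (K + 1))) as [N HN].
{ apply Rdiv_lt_0_compat; lra. }
exists N. intros n Hn. specialize (HN (Z.abs_nat (u n))).
specialize (Hu n). specialize (HN ltac:(lia)).
unfold Rdist in *. rewrite Rminus_0_r in *.
eapply Rle_lt_trans; [apply H|]. pose proof (Rle_abs (pterm a (Z.abs_nat (u n)))).
assert (Hq : eps / (K + 1) * (K + 1) = eps) by (field; lra).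
assert (0 < eps / (K + 1)) by (apply Rdiv_lt_0_compat; lra). nra.
Qed.

(** Translating by one period shifts the index by 1. A symmetric partial sum then changes by its two
    end terms only, and these tend to 0 by decay. *)
Lemma periodization_step a C f F x : 1 < a -> decays a C f -> periodization f F ->
  F (x + 2 * PI) = F x.
Proof.
intros Ha H HF. pose proof (decays_zdom a C f x ltac:(lra) H) as Hd.
apply (UL_sequence (zsum (fun k => f (x + 2 * PI + 2 * PI * IZR k)))); [apply HF|].
set (g := fun k : Z => f (x + 2 * PI * IZR k)) in *.
apply (Un_cv_ext (fun N => zsum g N + g (Z.of_nat (S N)) - g (- Z.of_nat N)%Z)).
- intros N. rewrite <- zsum_shift. apply zsum_ext. intros k. unfold g. f_equal.
  rewrite plus_IZR. ring.
- replace (F x) with (F x + 0 - 0) by ring. apply CV_minus; [apply CV_plus|].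
  + apply HF.
  + apply (zdom_cv a _ g (fun N => Z.of_nat (S N)) Ha Hd). intros; lia.
  + apply (zdom_cv a _ g (fun N => (- Z.of_nat N)%Z) Ha Hd). intros; lia.
Qed.

Lemma periodization_period a C f F x k : 1 < a -> decays a C f -> periodization f F ->
  F (x + 2 * PI * IZR k) = F x.
Proof.
intros Ha H HF.
assert (Hn : forall n y, F (y + 2 * PI * INR n) = F y).
{ induction n as [|n IH]; intros y.
  - simpl. f_equal. ring.
  - rewrite S_INR. replace (y + 2 * PI * (INR n + 1)) with (y + 2 * PI * INR n + 2 * PI) by ring.
    rewrite (periodization_step a C f F _ Ha H HF). apply IH. }
destruct (Z_le_gt_dec 0 k) as [Hk|Hk].
- rewrite <- (Z2Nat.id k Hk), <- INR_IZR_INZ. apply Hn.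
- rewrite <- (Hn (Z.to_nat (- k)) (x + 2 * PI * IZR k)). f_equal.
  rewrite INR_IZR_INZ, Z2Nat.id by lia. rewrite opp_IZR. ring.
Qed.

Lemma mod_2PI x : exists k : Z, 0 <= x - 2 * PI * IZR k < 2 * PI.
Proof.
pose proof PI_RGT_0. exists (Int_part (x / (2 * PI))).
destruct (base_Int_part (x / (2 * PI))) as [H1 H2].
assert (Hx : x = 2 * PI * (x / (2 * PI))) by (field; lra).
set (k := IZR (Int_part (x / (2 * PI)))) in *. set (y := x / (2 * PI)) in *.
rewrite Hx. split; nra.
Qed.

(** * Integrals folded onto one period *)

Lemma RInt_shift (h : R -> R) c A B : (forall y, continuous h y) ->
  RInt (fun x => h (x + c)) A B = RInt h (A + c) (B + c) :> R.
Proof.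
intros H.
pose proof (RInt_comp_lin h 1 c A B) as HH.
rewrite !Rmult_1_l in HH. rewrite <- HH.
- apply RInt_ext. intros x _. replace (1 * x + c) with (x + c) by ring. symmetry. apply Rmult_1_l.
- apply ex_RInt_continuous. intros; apply H.
Qed.

Lemma ex_RInt_cont (h : R -> R) A B : (forall y, continuous h y) -> ex_RInt h A B.
Proof. intros H. apply (ex_RInt_continuous (V := R_CompleteNormedModule)). intros; apply H. Qed.

Lemma RInt_plus_cont (f g : R -> R) A B :
  (forall y, continuous f y) -> (forall y, continuous g y) ->
  RInt (fun x => f x + g x) A B = RInt f A B + RInt g A B.
Proof.
intros Hf Hg.
apply (RInt_plus (V := R_CompleteNormedModule)); apply ex_RInt_cont; assumption.
Qed.

Lemma RInt_minus_cont (f g : R -> R) A B :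
  (forall y, continuous f y) -> (forall y, continuous g y) ->
  RInt (fun x => f x - g x) A B = RInt f A B - RInt g A B.
Proof.
intros Hf Hg.
apply (RInt_minus (V := R_CompleteNormedModule)); apply ex_RInt_cont; assumption.
Qed.

Lemma RInt_split (h : R -> R) A B C : (forall y, continuous h y) ->
  RInt h A C = RInt h A B + RInt h B C.
Proof.
intros H. symmetry.
apply (RInt_Chasles (V := R_CompleteNormedModule)); apply ex_RInt_cont, H.
Qed.

(** The window is off-centre because the [2 N + 1] periods indexed by [-N..N] start at [- 2 pi N],
    while the last one ends at [2 pi (N + 1)]. *)
Lemma RInt_zsum (h : R -> R) N : (forall y, continuous h y) ->
  RInt h (- (2 * PI * INR N)) (2 * PI * INR (S N))
    = RInt (fun x => zsum (fun k => h (x + 2 * PI * IZR k)) N) 0 (2 * PI) :> R.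
Proof.
intros H. induction N as [|N IH].
- simpl INR. rewrite Rmult_0_r, Ropp_0, Rmult_1_r. apply RInt_ext. intros x _.
  rewrite zsum_0. f_equal. ring.
- transitivity (RInt (fun x => zsum (fun k => h (x + 2 * PI * IZR k)) N +
     h (x + 2 * PI * IZR (Z.of_nat (S N))) + h (x + 2 * PI * IZR (- Z.of_nat (S N)))) 0 (2 * PI)).
  2:{ apply RInt_ext. intros x _. rewrite zsum_S. reflexivity. }
  assert (C1 : forall k y, continuous (fun x => h (x + 2 * PI * IZR k)) y).
  { intros k y. apply continuous_shift, H. }
  assert (C2 : forall y, continuous (fun x => zsum (fun k => h (x + 2 * PI * IZR k)) N) y).
  { intros y. apply (continuous_zsum (fun k x => h (x + 2 * PI * IZR k))), C1. }
  rewrite (RInt_plus_cont (fun x => zsum (fun k => h (x + 2 * PI * IZR k)) N +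
     h (x + 2 * PI * IZR (Z.of_nat (S N)))));
    [|intros; apply (continuous_plus (V := R_NormedModule)); auto|auto].
  rewrite RInt_plus_cont by auto.
  rewrite !RInt_shift by exact H. rewrite <- IH.
  rewrite opp_IZR, <- INR_IZR_INZ.
  replace (0 + 2 * PI * - INR (S N)) with (- (2 * PI * INR (S N))) by ring.
  replace (2 * PI + 2 * PI * - INR (S N)) with (- (2 * PI * INR N)) by (rewrite S_INR; ring).
  replace (0 + 2 * PI * INR (S N)) with (2 * PI * INR (S N)) by ring.
  replace (2 * PI + 2 * PI * INR (S N)) with (2 * PI * INR (S (S N)))
    by (rewrite (S_INR (S N)); ring).
  rewrite (RInt_split h (- (2 * PI * INR (S N))) (- (2 * PI * INR N))) by exact H.
  rewrite (RInt_split h (- (2 * PI * INR N)) (2 * PI * INR (S N)) (2 * PI * INR (S (S N))))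
    by exact H.
  ring.
Qed.

Lemma RInt_of_is_RInt g A B l : Defs.is_RInt g A B l -> RInt g A B = l :> R.
Proof. intros [pr <-]. apply RInt_Reals. Qed.

Lemma continuous_loc_RInt g : (forall x, continuous g x) -> loc_RInt g.
Proof.
intros H A B _. exists (RiemannInt (ex_RInt_Reals_0 g A B (ex_RInt_cont g A B H))).
eexists. reflexivity.
Qed.

Lemma RInt_abs_bound (h : R -> R) A B M : A <= B -> (forall y, continuous h y) ->
  (forall x, A <= x <= B -> Rabs (h x) <= M) -> Rabs (RInt h A B) <= (B - A) * M.
Proof.
intros HAB H HM. apply abs_RInt_le_const; [exact HAB|apply ex_RInt_cont, H|exact HM].
Qed.

(** Nonnegativity allows [[A, B]] to be enlarged to a window of whole periods. Folding the window
    onto [[0, 2 pi]] leaves the period length times the uniform bound of the symmetric sums there,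
    which is independent of the window. *)
Lemma decays_RInt_bound a C h A B : 1 < a -> decays a C h -> (forall y, continuous h y) ->
  (forall x, 0 <= h x) -> A <= B ->
  RInt h A B <= 2 * PI * (2 * (C * Rpower (1 + 2 * PI) a) * Series (pterm a)).
Proof.
intros Ha Hd Hc Hp HAB. pose proof PI_RGT_0 as Hpi.
assert (HN : exists N : nat, Rabs A <= 2 * PI * INR N /\ Rabs B <= 2 * PI * INR N).
{ destruct (INR_unbounded (Rabs A + Rabs B)) as [N HN]. exists N.
  pose proof (Rabs_pos A). pose proof (Rabs_pos B). pose proof PI2_1.
  pose proof (pos_INR N). split; nra. }
destruct HN as [N [HA HB]]. apply Rabs_le_between in HA. apply Rabs_le_between in HB.
assert (HS : 2 * PI * INR (S N) = 2 * PI * INR N + 2 * PI) by (rewrite S_INR; ring).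
assert (Hpos : forall X Y, X <= Y -> 0 <= RInt h X Y).
{ intros X Y HXY. apply RInt_ge_0; [exact HXY|apply ex_RInt_cont, Hc|intros; apply Hp]. }
pose proof (RInt_zsum h N Hc) as HZ.
rewrite (RInt_split h _ A), (RInt_split h A B) in HZ by exact Hc.
pose proof (Hpos (- (2 * PI * INR N)) A ltac:(lra)) as P1.
pose proof (Hpos B (2 * PI * INR (S N)) ltac:(lra)) as P2.
match type of HZ with _ = ?r =>
  assert (Hr : Rabs r <= (2 * PI - 0) * (2 * (C * Rpower (1 + 2 * PI) a) * Series (pterm a)))
end.
{ apply RInt_abs_bound; [lra| |].
  - intros y. apply (continuous_zsum (fun k x => h (x + 2 * PI * IZR k))).
    intros; apply continuous_shift, Hc.
  - intros x Hx. apply zsum_bound; [exact Ha|]. apply decays_zdom_le; [lra|exact Hd|].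
    rewrite Rabs_right; lra. }
apply Rabs_le_between in Hr. lra.
Qed.

Lemma decays_L1 a C h : 1 < a -> decays a C h -> (forall y, continuous h y) -> L1R h.
Proof.
intros Ha Hd Hc. split; [apply continuous_loc_RInt, Hc|].
exists (2 * PI * (2 * (C * Rpower (1 + 2 * PI) a) * Series (pterm a))).
intros A B l HAB Hl. rewrite <- (RInt_of_is_RInt _ _ _ _ Hl).
apply decays_RInt_bound; [exact Ha| | |intros; apply Rabs_pos|exact HAB].
- intros x. rewrite Rabs_Rabsolu. apply Hd.
- intros y. apply (continuous_comp h Rabs); [apply Hc|].
  apply continuity_pt_filterlim, Rcontinuity_abs.
Qed.

(** Since [(1 + |x|)^(- a) <= 1], the square still decays at rate [a], with constant [C * C], so the
    bound for nonnegative decaying functions applies again. *)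
Lemma decays_L2 a C h : 1 < a -> decays a C h -> (forall y, continuous h y) -> L2R h.
Proof.
intros Ha Hd Hc. split; [apply continuous_loc_RInt, Hc|].
exists (2 * PI * (2 * ((C * C) * Rpower (1 + 2 * PI) a) * Series (pterm a))).
intros A B l HAB Hl. rewrite <- (RInt_of_is_RInt _ _ _ _ Hl).
apply decays_RInt_bound; [exact Ha| | |intros; apply pow2_ge_0|exact HAB].
- intros x. rewrite <- RPow_abs. simpl. rewrite Rmult_1_r, Rmult_assoc.
  pose proof (Hd x) as Hx. pose proof (Rabs_pos (h x)).
  set (P := Rpower (1 + Rabs x) (- a)) in *.
  assert (HP : 0 < P) by apply exp_pos.
  assert (HP1 : P <= 1).
  { unfold P. replace 1 with (Rpower 1 (- a)) at 2
      by (unfold Rpower; rewrite ln_1, Rmult_0_r; apply exp_0).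
    apply Rpower_neg_le; [lra|]. pose proof (Rabs_pos x). lra. }
  pose proof (decays_nonneg _ _ _ Hd).
  apply Rle_trans with ((C * P) * (C * P)); [apply Rmult_le_compat; lra|]. 
  assert (0 <= C * C * P) by (apply Rmult_le_pos; nra). nra.
- intros y. apply (continuous_ext (fun x => mult (h x) (h x))).
  + intros x. unfold mult; simpl. ring.
  + apply (continuous_mult h h); apply Hc.
Qed.

(** With [2 pi N <= T <= 2 pi (N + 1)], the interval [[-T, T]] differs from the window of [2 N + 1]
    periods by a piece added on the left and a piece missing on the right. Both have length at most
    [2 pi] and lie where [|x| >= 2 pi N]. On the window, the folded sum is uniformly close to
    [s]. *)
Lemma decays_improper_int a C h s : 1 < a -> decays a C h -> (forall y, continuous h y) ->
  periodization h s -> is_improper_int h (RInt s 0 (2 * PI)).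
Proof.
intros Ha Hd Hc Hs. split; [apply continuous_loc_RInt, Hc|].
intros eps He. pose proof PI_RGT_0 as Hpi. pose proof (decays_nonneg _ _ _ Hd) as HC.
set (K := C * Rpower (1 + 2 * PI) a).
assert (HK : 0 <= K) by (apply Rmult_le_pos; [exact HC|left; apply exp_pos]).
assert (Hcs : forall y, continuous s y).
{ intros y. apply (periodization_continuous a C h s y Ha Hd Hc Hs). }
(* The total error: the first term is [2 pi] times the truncation error [2 * K * prest a N], the
   second is the two end pieces, each at most [2 pi * C * pterm a N]. *)
assert (Hlim : Un_cv (fun N => 4 * PI * K * prest a N + 4 * PI * C * pterm a N) 0).
{ replace 0 with (4 * PI * K * 0 + 4 * PI * C * 0) by ring.
  apply CV_plus; apply CV_mult; try apply Un_cv_const; [apply prest_cv|apply pterm_cv]; exact Ha. }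
destruct (Hlim eps He) as [N0 HN0].
(* One period beyond [N0], so that the number of whole periods below [T] is at least [N0]. *)
exists (2 * PI * INR (S N0)). intros T l' HT Hl'.
rewrite <- (RInt_of_is_RInt _ _ _ _ Hl').
assert (HN : exists N : nat, (N0 <= N)%nat /\ 2 * PI * INR N <= T <= 2 * PI * INR (S N)).
{ destruct (mod_2PI T) as [k Hk].
  assert (HSN : 2 * PI * INR (S N0) = 2 * PI * INR N0 + 2 * PI) by (rewrite S_INR; ring).
  assert (Hk0 : (Z.of_nat N0 < k)%Z).
  { apply lt_IZR. rewrite <- INR_IZR_INZ. nra. }
  exists (Z.to_nat k). rewrite S_INR, INR_IZR_INZ, Z2Nat.id by lia. split; [lia|]. lra. }
destruct HN as [N [HNN [HT1 HT2]]]. specialize (HN0 N HNN).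
unfold Rdist in HN0. rewrite Rminus_0_r in HN0.
eapply Rle_lt_trans; [|eapply Rle_lt_trans; [apply Rle_abs|exact HN0]].
assert (HSN : 2 * PI * INR (S N) = 2 * PI * INR N + 2 * PI) by (rewrite S_INR; ring).
pose proof (pos_INR N) as HNpos.
assert (Hsmall : forall X Y, X <= Y -> Y - X <= 2 * PI ->
   (forall x, X <= x <= Y -> 2 * PI * INR N <= Rabs x) ->
   Rabs (RInt h X Y) <= 2 * PI * (C * pterm a N)).
{ intros X Y HXY HL Hx.
  apply Rle_trans with ((Y - X) * (C * pterm a N)).
  - apply RInt_abs_bound; [exact HXY|exact Hc|]. intros x HxX.
    eapply Rle_trans; [apply Hd|]. apply Rmult_le_compat_l; [exact HC|].
    apply Rpower_neg_le; [lra|]. specialize (Hx x HxX). pose proof PI2_1. nra.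
  - apply Rmult_le_compat_r; [|exact HL].
    apply Rmult_le_pos; [exact HC|left; apply pterm_pos]. }
pose proof (RInt_zsum h N Hc) as HZ.
rewrite (RInt_split h _ T) in HZ by exact Hc.
rewrite (RInt_split h (- T) (- (2 * PI * INR N))) by exact Hc.
assert (B1 : Rabs (RInt h (- T) (- (2 * PI * INR N))) <= 2 * PI * (C * pterm a N)).
{ apply Hsmall; [lra|lra|]. intros x Hx. rewrite Rabs_left1; nra. }
assert (B2 : Rabs (RInt h T (2 * PI * INR (S N))) <= 2 * PI * (C * pterm a N)).
{ apply Hsmall; [lra|lra|]. intros x Hx. rewrite Rabs_right; nra. }
set (Sm := RInt (fun x => zsum (fun k => h (x + 2 * PI * IZR k)) N) 0 (2 * PI)) in *.
assert (B3 : Rabs (Sm - RInt s 0 (2 * PI)) <= (2 * PI - 0) * (2 * K * prest a N)).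
{ assert (Hcz : forall y, continuous (fun x => zsum (fun k => h (x + 2 * PI * IZR k)) N) y).
  { intros y. apply (continuous_zsum (fun k x => h (x + 2 * PI * IZR k))).
    intros; apply continuous_shift, Hc. }
  unfold Sm.
  rewrite <- RInt_minus_cont by assumption.
  apply RInt_abs_bound; [lra| |].
  - intros y. apply (continuous_minus (V := R_NormedModule)); [apply Hcz|apply Hcs].
  - intros x Hx. apply (zsum_rest a K); [exact Ha| |apply Hs].
    apply decays_zdom_le; [lra|exact Hd|]. rewrite Rabs_right; lra. }
apply Rabs_le_between in B1. apply Rabs_le_between in B2. apply Rabs_le_between in B3.
apply Rabs_le. lra.
Qed.

(** * Complex numbers and complex quaternions *)

Lemma continuous_periodic_bounded (g : R -> R) : (forall x, continuous g x) ->
  (forall x (k : Z), g (x + 2 * PI * IZR k) = g x) -> exists B, forall x, Rabs (g x) <= B.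
Proof.
intros Hc Hp. pose proof PI_RGT_0.
destruct (continuity_ab_maj (fun x => Rabs (g x)) 0 (2 * PI)) as [M [HM _]]; [lra| |].
- intros c _. apply (continuity_pt_comp g Rabs); [|apply Rcontinuity_abs].
  apply continuity_pt_filterlim, Hc.
- exists (Rabs (g M)). intros x. destruct (mod_2PI x) as [k Hk].
  rewrite <- (Hp x (- k)%Z), opp_IZR.
  replace (x + 2 * PI * - IZR k) with (x - 2 * PI * IZR k) by ring. apply HM. lra.
Qed.

Lemma CC_eq (z w : CC) : Cre z = Cre w -> Cim z = Cim w -> z = w.
Proof. destruct z, w; simpl; intros; subst; reflexivity. Qed.

Lemma CC_ring : ring_theory C0 C1 Cadd Cmul Csub Copp eq.
Proof.
constructor; intros; apply CC_eq; unfold Csub, Cadd, Cmul, Copp, C0, C1, Cre, Cim; simpl; ring.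
Qed.
Add Ring CCring : CC_ring.

Lemma Cnorm2_eq0 z : Cnorm2 z = 0 -> z = C0.
Proof.
unfold Cnorm2. intros H. apply CC_eq; change (Cre C0) with 0; change (Cim C0) with 0; nra.
Qed.

Lemma Cnorm2_pos z : z <> C0 -> 0 < Cnorm2 z.
Proof.
intros H. assert (H1 : 0 <= Cnorm2 z) by (unfold Cnorm2; nra).
destruct H1 as [H1|H1]; [exact H1|]. exfalso. apply H, Cnorm2_eq0. lra.
Qed.

Lemma Cmul_Cinv z : z <> C0 -> Cmul z (Cinv z) = C1.
Proof.
intros H. apply Cnorm2_pos in H.
apply CC_eq; unfold Cmul, Cinv, C1, Cre, Cim in *; simpl; unfold Cnorm2, Cre, Cim in *;
  field; lra.
Qed.

Lemma Cexp_add z w : Cexp (Cadd z w) = Cmul (Cexp z) (Cexp w).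
Proof.
apply CC_eq; unfold Cexp, Cmul, Cadd; simpl; rewrite exp_plus.
- rewrite cos_plus. ring.
- rewrite sin_plus. ring.
Qed.

Lemma Cexp_neq0 z : Cexp z <> C0.
Proof.
intros H. assert (H1 : Cmul (Cexp z) (Cexp (Copp z)) = C1).
{ rewrite <- Cexp_add. unfold Cexp, Cadd, Copp; simpl.
  rewrite !Rplus_opp_r, exp_0, cos_0, sin_0. apply CC_eq; simpl; ring. }
rewrite H in H1. apply (f_equal Cre) in H1. unfold Cmul, C0, C1 in H1. simpl in H1. lra.
Qed.

Lemma Cmul_neq0 z w : z <> C0 -> w <> C0 -> Cmul z w <> C0.
Proof.
intros Hz Hw H. apply Hw.
replace w with (Cmul (Cmul z (Cinv z)) w) by (rewrite (Cmul_Cinv z Hz); ring).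
replace (Cmul (Cmul z (Cinv z)) w) with (Cmul (Cinv z) (Cmul z w)) by ring.
rewrite H. ring.
Qed.

Definition Ccv (u : nat -> CC) (l : CC) : Prop :=
  Un_cv (fun n => Cre (u n)) (Cre l) /\ Un_cv (fun n => Cim (u n)) (Cim l).

Lemma Ccv_unique u l l' : Ccv u l -> Ccv u l' -> l = l'.
Proof. intros [H1 H2] [H3 H4]. apply CC_eq; eapply UL_sequence; eassumption. Qed.

Lemma Ccv_ext u v l : (forall n, u n = v n) -> Ccv u l -> Ccv v l.
Proof.
intros H [H1 H2].
split; [apply (Un_cv_ext (fun n => Cre (u n))) | apply (Un_cv_ext (fun n => Cim (u n)))];
  trivial; intros; rewrite H; reflexivity.
Qed.

Lemma Ccv_add u v l m : Ccv u l -> Ccv v m -> Ccv (fun n => Cadd (u n) (v n)) (Cadd l m).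
Proof. intros [H1 H2] [H3 H4]. split; apply CV_plus; assumption. Qed.

Lemma Ccv_scal c u l : Ccv u l -> Ccv (fun n => Cmul c (u n)) (Cmul c l).
Proof.
intros [H1 H2]. split; [apply CV_minus|apply CV_plus]; apply CV_mult; trivial; apply Un_cv_const.
Qed.

Definition Csum (h : nat -> CC) (N : nat) : CC :=
  (sum_f_R0 (fun k => Cre (h k)) N, sum_f_R0 (fun k => Cim (h k)) N).

Lemma Csum_scal c h N : Csum (fun k => Cmul c (h k)) N = Cmul c (Csum h N).
Proof.
induction N as [|N IH].
- apply CC_eq; reflexivity.
- transitivity (Cadd (Csum (fun k => Cmul c (h k)) N) (Cmul c (h (S N)))); [reflexivity|].
  rewrite IH. transitivity (Cmul c (Cadd (Csum h N) (h (S N)))); [ring|reflexivity].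
Qed.

Lemma Csum_ext h h' N : (forall k, h k = h' k) -> Csum h N = Csum h' N.
Proof. intros H. apply CC_eq; apply sum_eq; intros; rewrite H; reflexivity. Qed.

Definition Czsum (g : Z -> CC) (N : nat) : CC :=
  (zsum (fun k => Cre (g k)) N, zsum (fun k => Cim (g k)) N).

(** Stated at [S N] because [sum_f_R0] has no empty sum, which the negative half would be at 0.
    Indexing that half by [- S k] matches the terms [1 - alpha + k] of the second Hurwitz series. *)
Lemma zsum_one_sided g N : zsum g (S N) =
  sum_f_R0 (fun k => g (Z.of_nat k)) (S N) + sum_f_R0 (fun k => g (- Z.of_nat (S k))%Z) N.
Proof.
induction N as [|N IH]; rewrite zsum_S.
- rewrite zsum_0. simpl. ring.
- rewrite IH, (tech5 _ (S N)), (tech5 (fun k => g (- Z.of_nat (S k))%Z)). ring.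
Qed.

Lemma Czsum_one_sided g N : Czsum g (S N) =
  Cadd (Csum (fun k => g (Z.of_nat k)) (S N)) (Csum (fun k => g (- Z.of_nat (S k))%Z) N).
Proof. apply CC_eq; apply zsum_one_sided. Qed.

Lemma Czsum_scal c g N : Czsum (fun k => Cmul c (g k)) N = Cmul c (Czsum g N).
Proof.
unfold Czsum. apply CC_eq; simpl.
- unfold Rminus. rewrite Ropp_mult_distr_l, <- !zsum_scal, <- zsum_plus.
  apply zsum_ext. intros; ring.
- rewrite <- !zsum_scal, <- zsum_plus. reflexivity.
Qed.

(** * Periodization of complex-valued functions *)

Definition Ccontinuous (f : R -> CC) (x : R) : Prop :=
  continuous (fun t => Cre (f t)) x /\ continuous (fun t => Cim (f t)) x.
Definition Cdecays (a C : R) (f : R -> CC) : Prop :=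
  decays a C (fun t => Cre (f t)) /\ decays a C (fun t => Cim (f t)).
Definition Cperiodization (f F : R -> CC) : Prop :=
  forall x, Ccv (Czsum (fun k => f (x + 2 * PI * IZR k))) (F x).
Definition Cperiodic (f : R -> CC) : Prop := forall x k, f (x + 2 * PI * IZR k) = f x.

Lemma continuous_Rplus (f g : R -> R) x :
  continuous f x -> continuous g x -> continuous (fun t => f t + g t) x.
Proof. apply (continuous_plus (V := R_NormedModule)). Qed.

Lemma continuous_Rminus (f g : R -> R) x :
  continuous f x -> continuous g x -> continuous (fun t => f t - g t) x.
Proof. apply (continuous_minus (V := R_NormedModule)). Qed.

Lemma continuous_Rmult (f g : R -> R) x :
  continuous f x -> continuous g x -> continuous (fun t => f t * g t) x.
Proof. apply (continuous_mult f g). Qed.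

Lemma continuous_Rdiv (f g : R -> R) x : g x <> 0 ->
  continuous f x -> continuous g x -> continuous (fun t => f t / g t) x.
Proof.
intros H Hf Hg. apply continuous_Rmult; [exact Hf|].
apply (continuous_comp g Rinv); [exact Hg|].
apply continuity_pt_filterlim, (continuity_pt_inv id); [|exact H].
apply derivable_continuous_pt, derivable_pt_id.
Qed.

Lemma continuous_Ropp (f : R -> R) x : continuous f x -> continuous (fun t => - f t) x.
Proof. apply (continuous_opp (V := R_NormedModule)). Qed.

Lemma Ccontinuous_mul f g x :
  Ccontinuous f x -> Ccontinuous g x -> Ccontinuous (fun t => Cmul (f t) (g t)) x.
Proof.
intros [H1 H2] [H3 H4].
split; [apply continuous_Rminus|apply continuous_Rplus]; apply continuous_Rmult; assumption.
Qed.

Lemma Ccontinuous_inv f x : f x <> C0 -> Ccontinuous f x -> Ccontinuous (fun t => Cinv (f t)) x.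
Proof.
intros H [H1 H2]. pose proof (Cnorm2_pos _ H) as Hn.
assert (Hc : continuous (fun t => Cnorm2 (f t)) x).
{ apply continuous_Rplus; apply continuous_Rmult; assumption. }
split; apply continuous_Rdiv; try lra; trivial. apply continuous_Ropp, H2.
Qed.

Lemma Cperiodization_ex a C f : 1 < a -> Cdecays a C f -> exists F, Cperiodization f F.
Proof.
intros Ha [H1 H2].
destruct (periodization_ex a C _ Ha H1) as [F1 HF1].
destruct (periodization_ex a C _ Ha H2) as [F2 HF2].
exists (fun x => (F1 x, F2 x)). intros x. split; [apply HF1|apply HF2].
Qed.

Lemma Cperiodization_continuous a C f F x : 1 < a -> Cdecays a C f ->
  (forall y, Ccontinuous f y) -> Cperiodization f F -> Ccontinuous F x.
Proof.
intros Ha [H1 H2] Hc HF. split.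
- apply (periodization_continuous a C (fun t => Cre (f t))); trivial;
    intros y; apply Hc || apply HF.
- apply (periodization_continuous a C (fun t => Cim (f t))); trivial;
    intros y; apply Hc || apply HF.
Qed.

Lemma Cperiodization_periodic a C f F : 1 < a -> Cdecays a C f -> Cperiodization f F ->
  Cperiodic F.
Proof.
intros Ha [H1 H2] HF x k. apply CC_eq.
- apply (periodization_period a C (fun t => Cre (f t)) (fun t => Cre (F t))); trivial.
  intros y; apply HF.
- apply (periodization_period a C (fun t => Cim (f t)) (fun t => Cim (F t))); trivial.
  intros y; apply HF.
Qed.

(** A periodic factor is common to all terms of the sum. For the factor [e^(i m x) / P] the
    periodization of the product is [e^(i m x)] itself, which is the source of the cardinal
    property. *)
Lemma Cperiodization_mul f F k : Cperiodization f F -> Cperiodic k ->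
  Cperiodization (fun x => Cmul (k x) (f x)) (fun x => Cmul (k x) (F x)).
Proof.
intros HF Hk x. apply (Ccv_ext (fun N => Cmul (k x) (Czsum (fun j => f (x + 2 * PI * IZR j)) N))).
- intros N. rewrite <- Czsum_scal.
  apply CC_eq; apply zsum_ext; intros j; rewrite Hk; reflexivity.
- apply Ccv_scal, HF.
Qed.

Lemma Cdecays_mul a C f k : Cdecays a C f -> (forall x, Ccontinuous k x) -> Cperiodic k ->
  exists D, Cdecays a D (fun x => Cmul (k x) (f x)).
Proof.
intros [H1 H2] Hc Hk.
destruct (continuous_periodic_bounded (fun x => Cre (k x))) as [B1 HB1].
{ apply Hc. } { intros; rewrite Hk; reflexivity. }
destruct (continuous_periodic_bounded (fun x => Cim (k x))) as [B2 HB2].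
{ apply Hc. } { intros; rewrite Hk; reflexivity. }
(* Each component of a complex product has two terms, one with the real and one with the imaginary
   part of the bounded factor. *)
exists ((B1 + B2) * C).
assert (Hm : forall x (u v s t : R), Rabs u <= B1 -> Rabs v <= B2 ->
  Rabs s <= C * Rpower (1 + Rabs x) (- a) -> Rabs t <= C * Rpower (1 + Rabs x) (- a) ->
  Rabs u * Rabs s + Rabs v * Rabs t <= (B1 + B2) * C * Rpower (1 + Rabs x) (- a)).
{ intros x u v s t Hu Hv Hs Ht.
  rewrite Rmult_assoc, Rmult_plus_distr_r.
  apply Rplus_le_compat; apply Rmult_le_compat; trivial; apply Rabs_pos. }
split; intros x; unfold Cmul; simpl.
- eapply Rle_trans; [apply Rabs_triang|]. rewrite Rabs_Ropp, !Rabs_mult.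
  apply Hm; [apply HB1|apply HB2|apply H1|apply H2].
- eapply Rle_trans; [apply Rabs_triang|]. rewrite !Rabs_mult.
  apply Hm; [apply HB1|apply HB2|apply H2|apply H1].
Qed.

(* The complex quaternion $\chi_+ m + \chi_- p$ for the idempotents
   $\chi_\pm = (1 \pm i n)/2$ attached to a unit vector $n$; on them $n$ acts as $\mp i$. *)
Definition HCsplit (n1 n2 n3 : R) (p m : CC) : HC :=
  let s := Cmul (0, - / 2) (Csub p m) in
  mkHC (Cscal (/ 2) (Cadd p m)) (Cscal n1 s) (Cscal n2 s) (Cscal n3 s).

Lemma HC_eq x y : hc0 x = hc0 y -> hc1 x = hc1 y -> hc2 x = hc2 y -> hc3 x = hc3 y -> x = y.
Proof. destruct x, y; simpl; intros; subst; reflexivity. Qed.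

(** The two idempotents are orthogonal because [n] squares to [-1]. Products, and hence inverses,
    are therefore taken componentwise, and invertibility of [F_q] becomes nonvanishing of two scalar
    functions. *)
Lemma HCsplit_mul n1 n2 n3 p m p' m' : n1 * n1 + n2 * n2 + n3 * n3 = 1 ->
  HCmul (HCsplit n1 n2 n3 p m) (HCsplit n1 n2 n3 p' m')
  = HCsplit n1 n2 n3 (Cmul p p') (Cmul m m').
Proof.
intros H. assert (H1 : n1 * n1 = 1 - n2 * n2 - n3 * n3) by lra.
destruct p, m, p', m'.
unfold HCsplit, HCmul; apply HC_eq; simpl; apply CC_eq;
  unfold Csub, Cadd, Cmul, Copp, Cscal, Cre, Cim; simpl; field [H1].
Qed.

Lemma HCsplit_cscal n1 n2 n3 c p m :
  HCcscal c (HCsplit n1 n2 n3 p m) = HCsplit n1 n2 n3 (Cmul c p) (Cmul c m).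
Proof.
destruct p, m, c.
unfold HCsplit, HCcscal; apply HC_eq; simpl; apply CC_eq;
  unfold Csub, Cadd, Cmul, Copp, Cscal, Cre, Cim; simpl; ring.
Qed.

Lemma HCsplit_1 n1 n2 n3 : HCsplit n1 n2 n3 C1 C1 = HC1.
Proof.
apply HC_eq; simpl; apply CC_eq; unfold Csub, Cadd, Cmul, Copp, Cscal, C1, C0, Cre, Cim;
  simpl; field.
Qed.

Lemma HCsplit_0 n1 n2 n3 : HCsplit n1 n2 n3 C0 C0 = HC0.
Proof.
apply HC_eq; simpl; apply CC_eq; unfold Csub, Cadd, Cmul, Copp, Cscal, C1, C0, Cre, Cim;
  simpl; field.
Qed.

(** Each of the eight real coordinates is a fixed real-linear form in the two components, so
    continuity, decay and convergence pass from the components to the quaternion. *)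
Lemma HCproj_split n1 n2 n3 c : In c HCproj -> exists c1 c2 c3 c4, forall p m,
  c (HCsplit n1 n2 n3 p m) = c1 * Cre p + c2 * Cim p + c3 * Cre m + c4 * Cim m.
Proof.
intros H.
destruct H as [<-|[<-|[<-|[<-|[<-|[<-|[<-|[<-|[]]]]]]]]];
  unfold HCsplit, Csub, Cadd, Cmul, Copp, Cscal, Cre, Cim; simpl.
- exists (/ 2), 0, (/ 2), 0. intros; ring.
- exists 0, (/ 2), 0, (/ 2). intros; ring.
- exists 0, (n1 / 2), 0, (- n1 / 2). intros; field.
- exists (- n1 / 2), 0, (n1 / 2), 0. intros; field.
- exists 0, (n2 / 2), 0, (- n2 / 2). intros; field.
- exists (- n2 / 2), 0, (n2 / 2), 0. intros; field.
- exists 0, (n3 / 2), 0, (- n3 / 2). intros; field.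
- exists (- n3 / 2), 0, (n3 / 2), 0. intros; field.
Qed.

Definition Cpow (z w : CC) : CC :=
  if Req_EM_T (Cnorm2 z) 0 then C0 else Cexp (Cmul w (Clog z)).

(** Euler's formula: putting [i] and [-i] for the unit vector in [cos (nu L) + n sin (nu L)] gives
    [e^(i nu L)] and [e^(- i nu L)], which combine with [z^b] into the powers with exponents
    [b + i nu] and [b - i nu]. *)
Lemma qpow_split z p : HRvnorm p <> 0 ->
  qpow z p = HCsplit (hr1 p / HRvnorm p) (hr2 p / HRvnorm p) (hr3 p / HRvnorm p)
    (Cpow z (hr0 p, HRvnorm p)) (Cpow z (hr0 p, - HRvnorm p)).
Proof.
intros Hn. unfold qpow, Cpow. destruct (Req_EM_T (Cnorm2 z) 0).
{ rewrite HCsplit_0. reflexivity. }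
destruct (Req_EM_T (HRvnorm p) 0); [contradiction|].
set (nu := HRvnorm p) in *. set (b := hr0 p). set (L := Clog z).
assert (Hc : Cmul (Cpow_real z b) (Ccos (Cscal nu L))
   = Cscal (/ 2) (Cadd (Cexp (Cmul (b, nu) L)) (Cexp (Cmul (b, - nu) L)))
 /\ Cmul (Cpow_real z b) (Csin (Cscal nu L))
   = Cmul (0, - / 2) (Csub (Cexp (Cmul (b, nu) L)) (Cexp (Cmul (b, - nu) L)))).
{ unfold Cpow_real. fold L. destruct L as [l t].
  unfold Cexp, Csin, Ccos, Csub, Cadd, Cmul, Copp, Cscal, Cre, Cim; simpl.
  replace (b * l - nu * t) with (b * l + - (nu * t)) by ring.
  replace (b * l - - nu * t) with (b * l + nu * t) by ring.
  replace (b * t + - nu * l) with (b * t - nu * l) by ring.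
  rewrite !exp_plus, !cos_plus, !sin_plus, cos_minus, sin_minus. unfold cosh, sinh.
  split; apply CC_eq; simpl; field. }
destruct Hc as [Hc Hs]. unfold HCsplit. cbv zeta. rewrite Hc, Hs. reflexivity.
Qed.

(** * The powers of Xi *)

(** The difference quotient at 0 with the hole filled by the derivative. The real and imaginary
    parts of [Xi] are the slopes of [sin] and [cos], so continuity of [Xi] at 0 is differentiability
    of these functions. *)
Definition slope0 (f : R -> R) (l x : R) : R :=
  if Req_EM_T x 0 then l else (f x - f 0) / x.

Lemma slope0_continuous f l x : (forall y, continuous f y) -> derivable_pt_lim f 0 l ->
  continuous (slope0 f l) x.
Proof.
intros Hc Hd. destruct (Req_EM_T x 0) as [->|Hx].
- apply continuity_pt_filterlim. intros eps He. destruct (Hd eps He) as [d Hd'].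
  exists d. split; [apply cond_pos|]. intros y [_ Hy]. simpl in *. unfold Rdist in *.
  unfold slope0. destruct (Req_EM_T 0 0); [|contradiction].
  destruct (Req_EM_T y 0) as [->|Hy0].
  + rewrite Rminus_diag, Rabs_R0. exact He.
  + rewrite Rminus_0_r in Hy. specialize (Hd' y Hy0 Hy). rewrite Rplus_0_l in Hd'. exact Hd'.
- apply (continuous_ext_loc _ (fun y => (f y - f 0) / y)).
  + assert (H : locally x (fun y => y <> 0)).
    { apply (open_neq 0 x). exact Hx. }
    revert H. apply filter_imp. intros y Hy. unfold slope0.
    destruct (Req_EM_T y 0); [contradiction|reflexivity].
  + apply continuous_Rdiv; [exact Hx| |apply continuous_id].
    apply continuous_Rminus; [apply Hc|apply continuous_const].
Qed.

Lemma Xi_re x : Cre (Xi x) = slope0 sin 1 x.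
Proof.
unfold Xi, slope0. destruct (Req_EM_T x 0); [reflexivity|].
unfold Cdiv, Cinv, Cnorm2, Csub, Cadd, Cmul, Copp, Cscal, Cexp, C1, Ci, Cre, Cim; simpl.
rewrite !Rmult_0_r, exp_0, !Rmult_1_r, sin_neg, sin_0. field. exact n.
Qed.

Lemma Xi_im x : Cim (Xi x) = slope0 cos 0 x.
Proof.
unfold Xi, slope0. destruct (Req_EM_T x 0); [reflexivity|].
unfold Cdiv, Cinv, Cnorm2, Csub, Cadd, Cmul, Copp, Cscal, Cexp, C1, Ci, Cre, Cim; simpl.
rewrite !Rmult_0_r, exp_0, !Rmult_1_r, cos_neg, cos_0. field. exact n.
Qed.

Lemma continuous_sin x : continuous sin x.
Proof. apply continuity_pt_filterlim, continuity_sin. Qed.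

Lemma continuous_cos x : continuous cos x.
Proof. apply continuity_pt_filterlim, continuity_cos. Qed.

Lemma Xi_continuous x : Ccontinuous Xi x.
Proof.
split.
- apply (continuous_ext (slope0 sin 1)); [intros; symmetry; apply Xi_re|].
  apply slope0_continuous; [apply continuous_sin|].
  rewrite <- cos_0. apply derivable_pt_lim_sin.
- apply (continuous_ext (slope0 cos 0)); [intros; symmetry; apply Xi_im|].
  apply slope0_continuous; [apply continuous_cos|].
  replace 0 with (- sin 0) at 2 by (rewrite sin_0; ring). apply derivable_pt_lim_cos.
Qed.

(** * Principal argument and complex powers *)

Lemma Carg_right u v : 0 < u -> Carg (u, v) = atan (v / u).
Proof. intros H. unfold Carg; simpl. destruct (Rlt_dec 0 u); [reflexivity|contradiction]. Qed.

Lemma atan_inv_neg x : x < 0 -> atan (/ x) = - (PI / 2) - atan x.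
Proof.
intros H. pose proof (atan_inv (- x) ltac:(lra)) as Hi.
rewrite Rinv_opp, !atan_opp in Hi. lra.
Qed.

(** One formula for the open upper half-plane, including the imaginary axis where the definition of
    [Carg] changes branch; continuity there becomes visible. *)
Lemma Carg_upper u v : 0 < v -> Carg (u, v) = PI / 2 - atan (u / v).
Proof.
intros H. unfold Carg; simpl.
destruct (Rlt_dec 0 u); [|destruct (Rlt_dec u 0)].
- rewrite <- (Rinv_div u v), atan_inv; [reflexivity|]. apply Rdiv_lt_0_compat; lra.
- destruct (Rle_dec 0 v); [|lra].
  rewrite <- (Rinv_div u v), atan_inv_neg; [lra|].
  apply Rdiv_neg_pos; lra.
- destruct (Rlt_dec 0 v); [|lra]. replace u with 0 by lra.
  rewrite Rdiv_0_l, atan_0. ring.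
Qed.

Lemma Carg_lower u v : v < 0 -> Carg (u, v) = - (PI / 2) - atan (u / v).
Proof.
intros H. unfold Carg; simpl.
destruct (Rlt_dec 0 u); [|destruct (Rlt_dec u 0)].
- rewrite <- (Rinv_div u v), atan_inv_neg; [reflexivity|]. apply Rdiv_pos_neg; lra.
- destruct (Rle_dec 0 v); [lra|].
  rewrite <- (Rinv_div u v), atan_inv; [lra|].
  replace (u / v) with ((- u) / (- v)) by (field; lra). apply Rdiv_lt_0_compat; lra.
- destruct (Rlt_dec 0 v); [lra|]. destruct (Rlt_dec v 0); [|lra]. replace u with 0 by lra.
  rewrite Rdiv_0_l, atan_0. ring.
Qed.

Lemma Carg_bound z : Rabs (Carg z) <= PI.
Proof.
pose proof PI_RGT_0. destruct z as [u v]. apply Rabs_le.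
destruct (Rtotal_order v 0) as [Hv|[->|Hv]].
- rewrite Carg_lower by exact Hv. pose proof (atan_bound (u / v)). lra.
- unfold Carg; simpl. rewrite Rdiv_0_l, atan_0.
  repeat match goal with |- context [if ?b then _ else _] => destruct b end; lra.
- rewrite Carg_upper by exact Hv. pose proof (atan_bound (u / v)). lra.
Qed.

Lemma continuous_atan x : continuous atan x.
Proof. apply continuity_pt_filterlim, derivable_continuous_pt, derivable_pt_atan. Qed.

(** The slit plane is covered by three open half-planes, right, upper and lower; on each the
    argument is a single arctangent expression. *)
Lemma Carg_continuous (f : R -> CC) x : Ccontinuous f x -> 0 < Cre (f x) \/ Cim (f x) <> 0 ->
  continuous (fun t => Carg (f t)) x.
Proof.
intros [H1 H2] H.
assert (Hat : forall g h : R -> R, continuous g x -> continuous h x -> h x <> 0 ->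
   continuous (fun t => atan (g t / h t)) x).
{ intros g h Hg Hh Hn. apply (continuous_comp (fun t => g t / h t) atan); [|apply continuous_atan].
  apply continuous_Rdiv; assumption. }
assert (Hpair : forall t, f t = (Cre (f t), Cim (f t))) by (intros; destruct (f t); reflexivity).
assert (Hd : 0 < Cre (f x) \/ 0 < Cim (f x) \/ Cim (f x) < 0) by lra.
destruct Hd as [Hd|[Hd|Hd]].
- apply (continuous_ext_loc _ (fun t => atan (Cim (f t) / Cre (f t)))).
  + assert (HL : locally x (fun t => 0 < Cre (f t))).
    { apply (H1 (fun y => 0 < y)), open_gt, Hd. }
    revert HL. apply filter_imp. intros t Ht. rewrite (Hpair t) at 3. rewrite Carg_right; trivial.
  + apply Hat; trivial. lra.
- apply (continuous_ext_loc _ (fun t => PI / 2 - atan (Cre (f t) / Cim (f t)))).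
  + assert (HL : locally x (fun t => 0 < Cim (f t))).
    { apply (H2 (fun y => 0 < y)), open_gt, Hd. }
    revert HL. apply filter_imp. intros t Ht. rewrite (Hpair t) at 3. rewrite Carg_upper; trivial.
  + apply continuous_Rminus; [apply continuous_const|]. apply Hat; trivial. lra.
- apply (continuous_ext_loc _ (fun t => - (PI / 2) - atan (Cre (f t) / Cim (f t)))).
  + assert (HL : locally x (fun t => Cim (f t) < 0)).
    { apply (H2 (fun y => y < 0)), open_lt, Hd. }
    revert HL. apply filter_imp. intros t Ht. rewrite (Hpair t) at 3. rewrite Carg_lower; trivial.
  + apply continuous_Rminus; [apply continuous_const|]. apply Hat; trivial. lra.
Qed.

Lemma Cnorm2_continuous (f : R -> CC) x : Ccontinuous f x -> continuous (fun t => Cnorm2 (f t)) x.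
Proof. intros [H1 H2]. apply continuous_Rplus; apply continuous_Rmult; assumption. Qed.

Lemma Cnorm_continuous (f : R -> CC) x : Ccontinuous f x -> continuous (fun t => Cnorm (f t)) x.
Proof.
intros H. apply (continuous_comp (fun t => Cnorm2 (f t)) sqrt).
- apply Cnorm2_continuous, H.
- apply continuity_pt_filterlim, continuity_pt_sqrt. unfold Cnorm2. nra.
Qed.

Lemma Cnorm2_nonneg z : 0 <= Cnorm2 z.
Proof. unfold Cnorm2. nra. Qed.

Lemma Cnorm_pos z : Cnorm2 z <> 0 -> 0 < Cnorm z.
Proof. intros H. apply sqrt_lt_R0. pose proof (Cnorm2_nonneg z). lra. Qed.

Lemma Cexp_continuous (f : R -> CC) x : Ccontinuous f x -> Ccontinuous (fun t => Cexp (f t)) x.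
Proof.
intros [H1 H2].
assert (He : continuous (fun t => exp (Cre (f t))) x).
{ apply (continuous_comp (fun t => Cre (f t)) exp); [exact H1|].
  apply continuity_pt_filterlim, derivable_continuous_pt, derivable_pt_exp. }
split; apply continuous_Rmult; trivial.
- apply (continuous_comp (fun t => Cim (f t)) cos); [exact H2|apply continuous_cos].
- apply (continuous_comp (fun t => Cim (f t)) sin); [exact H2|apply continuous_sin].
Qed.

Lemma Ccontinuous_const c x : Ccontinuous (fun _ => c) x.
Proof. split; apply continuous_const. Qed.

Lemma Cpow_continuous_slit (f : R -> CC) w x : Ccontinuous f x ->
  0 < Cre (f x) \/ Cim (f x) <> 0 -> Ccontinuous (fun t => Cpow (f t) w) x.
Proof.
intros H Hs.
assert (Hn : Cnorm2 (f x) <> 0) by (unfold Cnorm2; nra).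
assert (HL : locally x (fun t => Cnorm2 (f t) <> 0)).
{ apply (Cnorm2_continuous f x H (fun y => y <> 0)), open_neq, Hn. }
assert (HC : Ccontinuous (fun t => Cexp (Cmul w (Clog (f t)))) x).
{ apply Cexp_continuous, Ccontinuous_mul; [apply Ccontinuous_const|]. split.
  - apply (continuous_comp (fun t => Cnorm (f t)) ln); [apply Cnorm_continuous, H|].
    apply continuity_pt_filterlim, derivable_continuous_pt.
    exists (/ Cnorm (f x)). apply derivable_pt_lim_ln, Cnorm_pos, Hn.
  - apply Carg_continuous; assumption. }
assert (HE : locally x (fun t => Cexp (Cmul w (Clog (f t))) = Cpow (f t) w)).
{ revert HL. apply filter_imp. intros t Ht. unfold Cpow.
  destruct (Req_EM_T (Cnorm2 (f t)) 0); [contradiction|reflexivity]. }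
destruct HC as [HC1 HC2].
split; [apply (continuous_ext_loc _ _ x) with (2 := HC1)
      |apply (continuous_ext_loc _ _ x) with (2 := HC2)];
 revert HE; apply filter_imp; intros t ->; reflexivity.
Qed.

Lemma Cexp_bound z : Rabs (Cre (Cexp z)) <= exp (Cre z) /\ Rabs (Cim (Cexp z)) <= exp (Cre z).
Proof.
pose proof (exp_pos (Cre z)). unfold Cexp; simpl.
rewrite !Rabs_mult, (Rabs_right (exp _)) by lra.
pose proof (COS_bound (Cim z)). pose proof (SIN_bound (Cim z)).
assert (Rabs (cos (Cim z)) <= 1) by (apply Rabs_le; lra).
assert (Rabs (sin (Cim z)) <= 1) by (apply Rabs_le; lra).
split; nra.
Qed.

(** [|z^w| = |z|^(Re w) e^(- Im w arg z)], and the argument is at most [PI] in absolute value,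
    whence the exponential factor. *)
Lemma Cpow_bound z w c : 0 < Cre w -> 0 < c -> Cnorm z <= c ->
  Rabs (Cre (Cpow z w)) <= exp (Rabs (Cim w) * PI) * Rpower c (Cre w) /\
  Rabs (Cim (Cpow z w)) <= exp (Rabs (Cim w) * PI) * Rpower c (Cre w).
Proof.
intros Hw Hc Hz. unfold Rpower. rewrite <- exp_plus.
unfold Cpow. destruct (Req_EM_T (Cnorm2 z) 0) as [E|E].
{ simpl. rewrite Rabs_R0. split; left; apply exp_pos. }
assert (Hle : exp (Cre (Cmul w (Clog z))) <= exp (Rabs (Cim w) * PI + Cre w * ln c)).
{ assert (He : Cre (Cmul w (Clog z)) <= Rabs (Cim w) * PI + Cre w * ln c).
  { unfold Cmul, Clog; simpl.
    assert (Hl : ln (Cnorm z) <= ln c) by (apply ln_le; [apply Cnorm_pos, E|exact Hz]).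
    assert (Ha : - (Cim w * Carg z) <= Rabs (Cim w) * PI).
    { eapply Rle_trans; [apply Rle_abs|]. rewrite Rabs_Ropp, Rabs_mult.
      apply Rmult_le_compat_l; [apply Rabs_pos|apply Carg_bound]. }
    assert (Cre w * ln (Cnorm z) <= Cre w * ln c) by (apply Rmult_le_compat_l; lra).
    lra. }
  destruct He as [He| ->]; [left; apply exp_increasing, He|right; reflexivity]. }
destruct (Cexp_bound (Cmul w (Clog z))) as [H1 H2]. split; lra.
Qed.

Lemma continuous_of_le_vanishing (f g : R -> R) x K : 0 <= K -> continuous g x ->
  g x = 0 -> f x = 0 -> (forall t, Rabs (f t) <= K * Rabs (g t)) -> continuous f x.
Proof.
intros HK Hg Hgx Hfx Hb. apply continuity_pt_filterlim. apply continuity_pt_filterlim in Hg.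
intros eps He. destruct (Hg (eps / (K + 1))) as [d [Hd HH]]; [apply Rdiv_lt_0_compat; lra|].
exists d. split; [exact Hd|]. intros y Hy. specialize (HH y Hy). simpl in *. unfold Rdist in *.
rewrite Hgx, Rminus_0_r in HH. rewrite Hfx, Rminus_0_r.
eapply Rle_lt_trans; [apply Hb|]. pose proof (Rabs_pos (g y)).
assert (Hq : eps / (K + 1) * (K + 1) = eps) by (field; lra). nra.
Qed.

(** * Size and continuity of the powers of Xi *)

Lemma cos_half x : cos x = 1 - 2 * (sin (x / 2) * sin (x / 2)).
Proof. replace x with (2 * (x / 2)) at 1 by field. rewrite cos_2a_sin. ring. Qed.

Lemma Xi_norm2 x : x <> 0 -> Cnorm2 (Xi x) = 4 * (sin (x / 2) * sin (x / 2)) / (x * x).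
Proof.
intros Hx. unfold Cnorm2. rewrite Xi_re, Xi_im. unfold slope0.
destruct (Req_EM_T x 0); [contradiction|]. rewrite sin_0, cos_0.
assert (E : sin x * sin x = 1 - cos x * cos x).
{ pose proof (sin2_cos2 x) as H. unfold Rsqr in H. lra. }
replace ((sin x - 0) / x * ((sin x - 0) / x) + (cos x - 1) / x * ((cos x - 1) / x))
  with ((sin x * sin x + (cos x - 1) * (cos x - 1)) / (x * x)) by (field; exact Hx).
rewrite E, (cos_half x). field. exact Hx.
Qed.

Lemma sqr_sin_le x : sin x * sin x <= x * x.
Proof.
assert (H : forall y, 0 <= y -> sin y * sin y <= y * y).
{ intros y [Hy| <-]; [|rewrite sin_0; lra].
  destruct (Rlt_le_dec y 1) as [H1|H1].
  - pose proof (sin_lt_x y Hy). pose proof PI2_1.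
    assert (0 < sin y) by (apply sin_gt_0; lra). nra.
  - pose proof (SIN_bound y). nra. }
destruct (Rle_dec 0 x) as [Hx|Hx]; [apply H, Hx|].
specialize (H (- x) ltac:(lra)). rewrite sin_neg in H. nra.
Qed.

(** The modulus [2 |sin (x/2)| / |x|] is at most 1 and at most [2 / |x|]. The former is below
    [4 / (1 + |x|)] for [|x| <= 1], the latter for [|x| >= 1]. *)
Lemma Xi_norm_bound x : Cnorm (Xi x) <= 4 * / (1 + Rabs x).
Proof.
pose proof (Rabs_pos x) as Hp.
assert (Hpos : 0 < / (1 + Rabs x)) by (apply Rinv_0_lt_compat; lra).
rewrite <- (sqrt_Rsqr (4 * / (1 + Rabs x))) by lra.
apply sqrt_le_1_alt. unfold Rsqr.
destruct (Req_EM_T x 0) as [->|Hx].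
- unfold Xi. destruct (Req_EM_T 0 0); [|contradiction].
  unfold Cnorm2, C1; simpl. rewrite Rabs_R0, Rplus_0_r, Rinv_1. lra.
- rewrite Xi_norm2 by exact Hx.
  assert (Hxx : x * x = Rabs x * Rabs x).
  { rewrite <- Rabs_mult. symmetry. apply Rabs_right. nra. }
  assert (Hax : 0 < Rabs x) by (apply Rabs_pos_lt, Hx).
  pose proof (sqr_sin_le (x / 2)) as Hs.
  assert (Hs1 : sin (x / 2) * sin (x / 2) <= 1).
  { pose proof (SIN_bound (x / 2)). nra. }
  rewrite Hxx. set (s := sin (x / 2) * sin (x / 2)) in *.
  assert (Hs2 : 4 * s <= Rabs x * Rabs x) by (rewrite <- Hxx; lra).
  set (r := Rabs x) in *.
  apply Rmult_le_reg_r with ((r * r) * ((1 + r) * (1 + r))); [nra|].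
  replace (4 * s / (r * r) * (r * r * ((1 + r) * (1 + r)))) with (4 * s * ((1 + r) * (1 + r)))
    by (field; lra).
  replace (4 * / (1 + r) * (4 * / (1 + r)) * (r * r * ((1 + r) * (1 + r)))) with (16 * (r * r))
    by (field; lra).
  destruct (Rle_dec r 1); nra.
Qed.

Definition Xipow (w : CC) (x : R) : CC := Cpow (Xi x) w.

Lemma Xipow_decays w : 1 < Cre w -> exists C, Cdecays (Cre w) C (Xipow w).
Proof.
intros Hw. exists (exp (Rabs (Cim w) * PI) * Rpower 4 (Cre w)).
assert (H : forall x, exp (Rabs (Cim w) * PI) * Rpower 4 (Cre w) * Rpower (1 + Rabs x) (- Cre w)
   = exp (Rabs (Cim w) * PI) * Rpower (4 * / (1 + Rabs x)) (Cre w)).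
{ intros x. pose proof (Rabs_pos x).
  assert (0 < / (1 + Rabs x)) by (apply Rinv_0_lt_compat; lra).
  rewrite <- Rpower_mult_distr by lra. rewrite Rmult_assoc. do 2 f_equal.
  unfold Rpower. rewrite ln_Rinv by lra. f_equal. ring. }
split; intros x; rewrite H; pose proof (Rabs_pos x);
 (apply Cpow_bound; [lra| |apply Xi_norm_bound]);
 (apply Rmult_lt_0_compat; [lra|apply Rinv_0_lt_compat; lra]).
Qed.

(** Away from 0 the imaginary part is [(cos x - 1) / x], and its vanishing forces [sin (x/2) = 0],
    hence [Xi x = 0]. The curve [Xi] thus never touches the open negative half-line, where the
    principal logarithm jumps. *)
Lemma Xi_eq0 x : Cim (Xi x) = 0 -> Xi x = C0 \/ Xi x = C1.
Proof.
intros H. destruct (Req_EM_T x 0) as [->|Hx].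
{ right. unfold Xi. destruct (Req_EM_T 0 0); [reflexivity|contradiction]. }
left. apply Cnorm2_eq0. rewrite Xi_norm2 by exact Hx.
rewrite Xi_im in H. unfold slope0 in H. destruct (Req_EM_T x 0); [contradiction|].
rewrite cos_0, cos_half in H.
assert (E : sin (x / 2) * sin (x / 2) = 0).
{ apply (f_equal (fun y => - y * x / 2)) in H. field_simplify in H; [|exact Hx]. nra. }
rewrite E. unfold Rdiv. ring.
Qed.

(** Splitting [|z|^(Re w) = |z|^(Re w - 1) |z|] and bounding the first factor through [|z| <= 4]
    gives a linear bound at the origin, which yields continuity of [Xi^w] at the zeros of [Xi]. *)
Lemma Cpow_le_Cnorm z w : 1 < Cre w -> Cnorm z <= 4 ->
  Rabs (Cre (Cpow z w)) <= exp (Rabs (Cim w) * PI) * Rpower 4 (Cre w) * Rabs (Cnorm z) /\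
  Rabs (Cim (Cpow z w)) <= exp (Rabs (Cim w) * PI) * Rpower 4 (Cre w) * Rabs (Cnorm z).
Proof.
intros Hw Hz. assert (HK : 0 < exp (Rabs (Cim w) * PI)) by apply exp_pos.
destruct (Req_EM_T (Cnorm2 z) 0) as [E|E].
{ unfold Cpow. destruct (Req_EM_T (Cnorm2 z) 0); [|contradiction]. simpl.
  rewrite Rabs_R0. assert (0 < Rpower 4 (Cre w)) by apply exp_pos.
  assert (0 <= exp (Rabs (Cim w) * PI) * Rpower 4 (Cre w) * Rabs (Cnorm z)).
  { apply Rmult_le_pos; [|apply Rabs_pos]. nra. }
  split; assumption. }
pose proof (Cnorm_pos z E) as Hp. rewrite (Rabs_right (Cnorm z)) by lra.
assert (Hr : Rpower (Cnorm z) (Cre w) <= Rpower 4 (Cre w) * Cnorm z).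
{ replace (Cre w) with ((Cre w - 1) + 1) at 1 by ring. rewrite Rpower_plus, Rpower_1 by exact Hp.
  apply Rmult_le_compat_r; [lra|].
  apply Rle_trans with (Rpower 4 (Cre w - 1)); [apply Rle_Rpower_l; lra|].
  apply Rle_Rpower; lra. }
destruct (Cpow_bound z w (Cnorm z) ltac:(lra) Hp (Rle_refl _)) as [H1 H2].
assert (Hr2 : exp (Rabs (Cim w) * PI) * Rpower (Cnorm z) (Cre w)
   <= exp (Rabs (Cim w) * PI) * Rpower 4 (Cre w) * Cnorm z).
{ rewrite Rmult_assoc. apply Rmult_le_compat_l; lra. }
split; lra.
Qed.

Lemma Xipow_continuous w x : 1 < Cre w -> Ccontinuous (Xipow w) x.
Proof.
intros Hw. destruct (Req_EM_T (Cim (Xi x)) 0) as [Him|Him].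
- destruct (Xi_eq0 x Him) as [H0|H1].
  + assert (Hb : forall t, Cnorm (Xi t) <= 4).
    { intros t. eapply Rle_trans; [apply Xi_norm_bound|].
      pose proof (Rabs_pos t). rewrite <- (Rmult_1_r 4) at 2.
      apply Rmult_le_compat_l; [lra|]. rewrite <- Rinv_1. apply Rinv_le_contravar; lra. }
    assert (HK : 0 <= exp (Rabs (Cim w) * PI) * Rpower 4 (Cre w)).
    { apply Rmult_le_pos; left; apply exp_pos. }
    assert (HN : Cnorm (Xi x) = 0).
    { rewrite H0. unfold Cnorm, Cnorm2, C0; simpl. rewrite Rmult_0_l, Rplus_0_r. apply sqrt_0. }
    assert (HP : Xipow w x = C0).
    { unfold Xipow, Cpow. rewrite H0. destruct (Req_EM_T (Cnorm2 C0) 0) as [|n]; [reflexivity|].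
      exfalso. apply n. unfold Cnorm2, C0; simpl. ring. }
    split; apply (continuous_of_le_vanishing _ (fun t => Cnorm (Xi t)) x _ HK);
      trivial; try (apply Cnorm_continuous, Xi_continuous); try (rewrite HP; reflexivity);
      intros t; apply Cpow_le_Cnorm; trivial.
  + apply Cpow_continuous_slit; [apply Xi_continuous|]. left. rewrite H1. simpl. lra.
- apply Cpow_continuous_slit; [apply Xi_continuous|]. right; exact Him.
Qed.

(** * Hurwitz series and nonvanishing *)

Lemma cos_sin_period_Z x k :
  cos (x + 2 * PI * IZR k) = cos x /\ sin (x + 2 * PI * IZR k) = sin x.
Proof.
assert (H : forall n y, cos (y + 2 * PI * INR n) = cos y /\ sin (y + 2 * PI * INR n) = sin y).
{ intros n y. replace (y + 2 * PI * INR n) with (y + 2 * INR n * PI) by ring.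
  split; [apply cos_period|apply sin_period]. }
destruct (Z_le_gt_dec 0 k) as [Hk|Hk].
- rewrite <- (Z2Nat.id k Hk), <- INR_IZR_INZ. apply H.
- destruct (H (Z.to_nat (- k)) (x + 2 * PI * IZR k)) as [H1 H2].
  rewrite <- H1, <- H2, INR_IZR_INZ, Z2Nat.id, opp_IZR by lia.
  split; f_equal; ring.
Qed.

(** The quotient is [- cot (h/2) = tan (h/2 - pi/2)], and [h/2 - pi/2] lies in the range of
    [atan]. *)
Lemma atan_cot_half h : 0 < h < 2 * PI -> atan (sin h / (cos h - 1)) = h / 2 - PI / 2.
Proof.
intros H. assert (Hs : 0 < sin (h / 2)) by (apply sin_gt_0; lra).
rewrite <- (atan_tan (h / 2 - PI / 2)) by lra. f_equal.
unfold tan. rewrite sin_minus, cos_minus, sin_PI2, cos_PI2.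
assert (E : sin h = 2 * sin (h / 2) * cos (h / 2)).
{ replace h with (2 * (h / 2)) at 1 by field. apply sin_2a. }
rewrite (cos_half h), E. field. split; nra.
Qed.

(** [Xi x] is the vector [(sin h, cos h - 1)], the same for all [k] and in the lower half-plane,
    divided by [x]. For [k >= 0] this only rescales it; for [k < 0] it also reflects it into the
    upper half-plane, which adds [PI] to the argument. *)
Lemma Clog_Xi h k : 0 < h < 2 * PI ->
  Cnorm2 (Xi (h + 2 * PI * IZR k)) <> 0 /\
  Clog (Xi (h + 2 * PI * IZR k)) =
    (ln (sin (h / 2) / PI) - ln (Rabs (h / (2 * PI) + IZR k)),
     (if Z_lt_dec k 0 then PI else 0) - h / 2).
Proof.
intros Hh. set (x := h + 2 * PI * IZR k). pose proof PI_RGT_0 as Hpi.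
assert (Hs : 0 < sin (h / 2)) by (apply sin_gt_0; lra).
destruct (cos_sin_period_Z h k) as [Hc Hsn]. fold x in Hc, Hsn.
assert (Hcos : cos h - 1 < 0) by (rewrite (cos_half h); nra).
assert (Hx : x < 0 /\ (k < 0)%Z \/ 0 < x /\ (0 <= k)%Z).
{ destruct (Z_lt_dec k 0) as [Hk|Hk]; [left|right]; (split; [|lia]); unfold x.
  - assert (IZR k <= -1) by (apply IZR_le; lia). nra.
  - assert (0 <= IZR k) by (apply IZR_le; lia). nra. }
assert (Hx0 : x <> 0) by lra.
assert (Hax : 0 < Rabs (h / (2 * PI) + IZR k)).
{ apply Rabs_pos_lt. intros E. apply Hx0. unfold x.
  replace (h + 2 * PI * IZR k) with (2 * PI * (h / (2 * PI) + IZR k)) by (field; lra).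
  rewrite E. ring. }
assert (HN : Cnorm2 (Xi x) = Rsqr (sin (h / 2) / PI / Rabs (h / (2 * PI) + IZR k))).
{ rewrite Xi_norm2 by exact Hx0. unfold Rsqr.
  assert (E : sin (x / 2) * sin (x / 2) = sin (h / 2) * sin (h / 2)).
  { pose proof (cos_half x). pose proof (cos_half h). lra. }
  rewrite E.
  assert (E2 : x * x = (2 * PI) * (2 * PI) *
     (Rabs (h / (2 * PI) + IZR k) * Rabs (h / (2 * PI) + IZR k))).
  { rewrite <- Rabs_mult, Rabs_right.
    - unfold x. field. lra.
    - apply Rle_ge, Rle_0_sqr. }
  rewrite E2. field. split; lra. }
assert (Hpos : 0 < sin (h / 2) / PI / Rabs (h / (2 * PI) + IZR k)).
{ apply Rdiv_lt_0_compat; [apply Rdiv_lt_0_compat|]; assumption. }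
split; [rewrite HN; unfold Rsqr; nra|].
unfold Clog. f_equal.
- unfold Cnorm. rewrite HN, sqrt_Rsqr by lra.
  rewrite ln_div; [reflexivity| |exact Hax]. apply Rdiv_lt_0_compat; assumption.
- assert (HX : Xi x = (sin h / x, (cos h - 1) / x)).
  { apply CC_eq; [rewrite Xi_re|rewrite Xi_im]; unfold slope0;
      (destruct (Req_EM_T x 0); [contradiction|]).
    - rewrite sin_0, Hsn, Rminus_0_r. reflexivity.
    - rewrite cos_0, Hc. reflexivity. }
  rewrite HX.
  assert (HR : sin h / x / ((cos h - 1) / x) = sin h / (cos h - 1)) by (field; lra).
  destruct (Z_lt_dec k 0) as [Hk|Hk].
  + destruct Hx as [[Hx1 _]|[_ Hk1]]; [|lia].
    rewrite Carg_upper, HR, atan_cot_half by (assumption || apply Rdiv_neg_neg; lra). field.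
  + destruct Hx as [[_ Hk1]|[Hx1 _]]; [lia|].
    rewrite Carg_lower, HR, atan_cot_half by (assumption || apply Rdiv_neg_pos; lra). field.
Qed.

Lemma Xipow_hurwitz w h : 0 < h < 2 * PI -> exists c, c <> C0 /\
  (forall n : nat, Xipow w (h + 2 * PI * IZR (Z.of_nat n))
     = Cmul c (hurwitz_term w (h / (2 * PI)) n)) /\
  (forall n : nat, Xipow w (h + 2 * PI * IZR (- Z.of_nat (S n)))
     = Cmul (Cmul c (Cexp (Cmul (Cscal PI Ci) w))) (hurwitz_term w (1 - h / (2 * PI)) n)).
Proof.
(* The part of [w log Xi] that does not depend on [k], exponentiated. *)
intros Hh. exists (Cexp (Cmul w (ln (sin (h / 2) / PI), - (h / 2)))).
pose proof PI_RGT_0 as Hpi.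
assert (Ha : 0 < h / (2 * PI) < 1).
{ split; [apply Rdiv_lt_0_compat; lra|]. apply (Rdiv_lt_1 h); lra. }
split; [apply Cexp_neq0|split]; intros n.
- destruct (Clog_Xi h (Z.of_nat n) Hh) as [H1 H2]. unfold Xipow, Cpow.
  destruct (Req_EM_T _ 0); [contradiction|].
  unfold hurwitz_term. rewrite <- Cexp_add, H2. f_equal.
  destruct (Z_lt_dec (Z.of_nat n) 0); [lia|].
  rewrite <- INR_IZR_INZ, Rabs_right by (pose proof (pos_INR n); lra).
  apply CC_eq; unfold RtoC, Cmul, Cadd, Copp, Cre, Cim; simpl; ring.
- destruct (Clog_Xi h (- Z.of_nat (S n)) Hh) as [H1 H2]. unfold Xipow, Cpow.
  destruct (Req_EM_T _ 0); [contradiction|].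
  unfold hurwitz_term. rewrite <- !Cexp_add, H2. f_equal.
  destruct (Z_lt_dec (- Z.of_nat (S n)) 0); [|lia].
  rewrite opp_IZR, <- INR_IZR_INZ, S_INR, Rabs_left by (pose proof (pos_INR n); lra).
  (* For [k = - (n + 1)] one has [|alpha + k| = (1 - alpha) + n], the base of the [n]-th term of
     [zeta(w, 1 - alpha)]. *)
  replace (- (h / (2 * PI) + - (INR n + 1))) with (1 - h / (2 * PI) + INR n) by ring.
  apply CC_eq; unfold RtoC, Ci, Cscal, Cmul, Cadd, Copp, Cre, Cim; simpl; ring.
Qed.

(** The nonvanishing hypothesis speaks of arbitrary limits [z1], [z2] of the Hurwitz series; their
    existence must be supplied before it can be applied. *)
Lemma hurwitz_ex w a : 1 < Cre w -> 0 < a < 1 -> exists z, is_hurwitz w a z.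
Proof.
intros Hw Ha.
(* Since [a < 1], [a + k >= a (1 + k)], so the terms are dominated by a multiple of [pterm]. *)
assert (Hdom : forall k, exp (Cre (Cmul (Copp w) (RtoC (ln (a + INR k)))))
   <= Rpower a (- Cre w) * pterm (Cre w) k).
{ intros k. pose proof (pos_INR k) as Hk. unfold pterm.
  rewrite Rpower_mult_distr by lra.
  replace (exp _) with (Rpower (a + INR k) (- Cre w)).
  - apply Rpower_neg_le; [lra|]. nra.
  - unfold Rpower. f_equal. unfold Cmul, Copp, RtoC; simpl. ring. }
assert (Hex : forall c : nat -> R, (forall k, Rabs (c k) <= Rpower a (- Cre w) * pterm (Cre w) k) ->
   exists l, Un_cv (sum_f_R0 c) l).
{ intros c Hc. exists (Series c). apply is_lim_seq_Reals.
  apply (is_lim_seq_ext (sum_n c)); [intros; apply sum_n_Reals|].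
  apply (Series_correct c).
  apply (ex_series_le (V := R_CompleteNormedModule) c
    (fun k => Rpower a (- Cre w) * pterm (Cre w) k)).
  - exact Hc.
  - apply (ex_series_scal (V := R_NormedModule)), ex_series_pterm, Hw. }
destruct (Hex (fun k => Cre (hurwitz_term w a k))) as [x Hx].
{ intros k. eapply Rle_trans; [apply Cexp_bound|apply Hdom]. }
destruct (Hex (fun k => Cim (hurwitz_term w a k))) as [y Hy].
{ intros k. eapply Rle_trans; [apply Cexp_bound|apply Hdom]. }
exists (x, y). split; assumption.
Qed.

Lemma Ccv_shift u l : Ccv u l -> Ccv (fun n => u (S n)) l.
Proof.
intros [H1 H2]. split.
- apply (Un_cv_ext (fun n => Cre (u (n + 1)%nat))).
  + intros n. rewrite Nat.add_1_r. reflexivity.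
  + apply (CV_shift' (fun n => Cre (u n))), H1.
- apply (Un_cv_ext (fun n => Cim (u (n + 1)%nat))).
  + intros n. rewrite Nat.add_1_r. reflexivity.
  + apply (CV_shift' (fun n => Cim (u n))), H2.
Qed.

Lemma Xipow_0 w : Xipow w 0 = C1.
Proof.
assert (H : Xi 0 = C1) by (unfold Xi; destruct (Req_EM_T 0 0); [reflexivity|contradiction]).
unfold Xipow, Cpow. rewrite H.
assert (HN : Cnorm2 C1 = 1) by (unfold Cnorm2, C1; simpl; ring).
rewrite HN. destruct (Req_EM_T 1 0); [lra|].
unfold Clog, Cnorm. rewrite HN, sqrt_1, ln_1. unfold C1.
rewrite (Carg_right 1 0) by lra. rewrite Rdiv_0_l, atan_0.
apply CC_eq; unfold Cexp, Cmul; simpl; rewrite !Rmult_0_r, Rminus_0_r, Rplus_0_r, exp_0,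
  ?cos_0, ?sin_0; ring.
Qed.

Lemma Xipow_2kPI w k : k <> 0%Z -> Xipow w (0 + 2 * PI * IZR k) = C0.
Proof.
intros Hk. pose proof PI_RGT_0.
assert (Hx : 0 + 2 * PI * IZR k <> 0).
{ rewrite Rplus_0_l. apply Rmult_integral_contrapositive_currified; [lra|].
  intros E. apply Hk, eq_IZR, E. }
unfold Xipow, Cpow. destruct (Req_EM_T _ 0) as [|n]; [reflexivity|].
exfalso. apply n. unfold Cnorm2. rewrite Xi_re, Xi_im. unfold slope0.
destruct (cos_sin_period_Z 0 k) as [-> ->].
destruct (Req_EM_T (0 + 2 * PI * IZR k) 0); [contradiction|].
rewrite Rminus_diag, Rdiv_0_l, Rminus_diag, Rdiv_0_l. ring.
Qed.

Lemma Xipow_periodization_neq0 w F : 1 < Cre w -> Cperiodization (Xipow w) F -> Cperiodic F ->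
  (forall alpha, 0 < alpha < 1 -> forall z1 z2,
     is_hurwitz w alpha z1 -> is_hurwitz w (1 - alpha) z2 ->
     Cadd z1 (Cmul (Cexp (Cmul (Cscal PI Ci) w)) z2) <> C0) ->
  forall x, F x <> C0.
Proof.
intros Hw HF Hp Hz x. destruct (mod_2PI x) as [k Hk].
replace x with ((x - 2 * PI * IZR k) + 2 * PI * IZR k) by ring. rewrite Hp.
set (h := x - 2 * PI * IZR k) in *. pose proof PI_RGT_0.
destruct Hk as [[Hk0|Hk0] Hk1].
- destruct (Xipow_hurwitz w h (conj Hk0 Hk1)) as [c [Hc [H1 H2]]].
  assert (Ha : 0 < h / (2 * PI) < 1).
  { split; [apply Rdiv_lt_0_compat; lra|]. apply (Rdiv_lt_1 h); lra. }
  destruct (hurwitz_ex w (h / (2 * PI)) Hw Ha) as [z1 Hz1].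
  destruct (hurwitz_ex w (1 - h / (2 * PI)) Hw ltac:(lra)) as [z2 Hz2].
  set (e := Cexp (Cmul (Cscal PI Ci) w)) in *.
  replace (F h) with (Cmul c (Cadd z1 (Cmul e z2))).
  { apply Cmul_neq0; [exact Hc|]. apply (Hz _ Ha); assumption. }
  (* The limits are compared along [S N], where the symmetric sum separates into its two one-sided
     halves. *)
  apply (Ccv_unique (fun N => Czsum (fun k => Xipow w (h + 2 * PI * IZR k)) (S N)));
    [|apply (Ccv_shift (Czsum _)), HF].
  apply (Ccv_ext (fun N => Cadd (Cmul c (Csum (hurwitz_term w (h / (2 * PI))) (S N)))
     (Cmul (Cmul c e) (Csum (hurwitz_term w (1 - h / (2 * PI))) N)))).
  + intros N. rewrite Czsum_one_sided, <- !Csum_scal. f_equal; apply Csum_ext; intros j; symmetry.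
    * apply H1.
    * apply H2.
  + replace (Cmul c (Cadd z1 (Cmul e z2))) with (Cadd (Cmul c z1) (Cmul (Cmul c e) z2)) by ring.
    apply Ccv_add; apply Ccv_scal.
    * apply (Ccv_shift (Csum _)). exact Hz1.
    * exact Hz2.
(* Here [alpha = 0] is outside the Hurwitz condition. [Xi] is 1 at 0 and vanishes at every other
   multiple of [2 pi], so all partial sums equal 1. *)
- rewrite <- Hk0. replace (F 0) with C1.
  { intros E. apply (f_equal Cre) in E. unfold C1, C0 in E; simpl in E. lra. }
  apply (Ccv_unique (Czsum (fun k => Xipow w (0 + 2 * PI * IZR k)))); [|apply HF].
  apply (Ccv_ext (fun _ => C1)); [|split; apply Un_cv_const].
  intros N. assert (E0 : Xipow w (0 + 2 * PI * 0) = C1).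
  { replace (0 + 2 * PI * 0) with 0 by ring. apply Xipow_0. }
  apply CC_eq; simpl; induction N as [|N IH]; rewrite ?zsum_0, ?zsum_S, <- ?IH;
    rewrite ?E0; trivial; rewrite !Xipow_2kPI by lia; simpl; ring.
Qed.

(** * The cardinal property *)

Lemma HCproj_split_continuous n1 n2 n3 c f g : In c HCproj ->
  (forall x, Ccontinuous f x) -> (forall x, Ccontinuous g x) ->
  forall x, continuous (fun t => c (HCsplit n1 n2 n3 (f t) (g t))) x.
Proof.
intros Hc Hf Hg x. destruct (HCproj_split n1 n2 n3 c Hc) as [c1 [c2 [c3 [c4 H]]]].
apply (continuous_ext (fun t => c1 * Cre (f t) + c2 * Cim (f t) + c3 * Cre (g t) + c4 * Cim (g t))).
- intros t. symmetry. apply H.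
- repeat apply continuous_Rplus; (apply continuous_Rmult; [apply continuous_const|]);
  apply Hf || apply Hg.
Qed.

Lemma HCproj_split_decays n1 n2 n3 c a C D f g : In c HCproj -> Cdecays a C f -> Cdecays a D g ->
  exists E, decays a E (fun t => c (HCsplit n1 n2 n3 (f t) (g t))).
Proof.
intros Hc [F1 F2] [G1 G2]. destruct (HCproj_split n1 n2 n3 c Hc) as [c1 [c2 [c3 [c4 H]]]].
exists (Rabs c1 * C + Rabs c2 * C + Rabs c3 * D + Rabs c4 * D). intros x. rewrite H.
specialize (F1 x). specialize (F2 x). specialize (G1 x). specialize (G2 x). cbv beta in *.
set (P := Rpower (1 + Rabs x) (- a)) in *.
assert (Hm : forall c u K, Rabs u <= K * P -> Rabs (c * u) <= Rabs c * K * P).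
{ intros d u K Hu. rewrite Rabs_mult, Rmult_assoc.
  apply Rmult_le_compat_l; [apply Rabs_pos|exact Hu]. }
apply (Hm c1) in F1. apply (Hm c2) in F2. apply (Hm c3) in G1. apply (Hm c4) in G2.
eapply Rle_trans; [apply Rabs_triang|]. rewrite !Rmult_plus_distr_r.
apply Rplus_le_compat; [|exact G2].
eapply Rle_trans; [apply Rabs_triang|]. apply Rplus_le_compat; [|exact G1].
eapply Rle_trans; [apply Rabs_triang|]. apply Rplus_le_compat; assumption.
Qed.

Lemma HCproj_split_cv n1 n2 n3 c f g P M : In c HCproj -> Ccv (Czsum f) P -> Ccv (Czsum g) M ->
  Un_cv (zsum (fun k => c (HCsplit n1 n2 n3 (f k) (g k)))) (c (HCsplit n1 n2 n3 P M)).
Proof.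
intros Hc [F1 F2] [G1 G2]. destruct (HCproj_split n1 n2 n3 c Hc) as [c1 [c2 [c3 [c4 H]]]].
rewrite H.
apply (Un_cv_ext (fun N => c1 * zsum (fun k => Cre (f k)) N + c2 * zsum (fun k => Cim (f k)) N
   + c3 * zsum (fun k => Cre (g k)) N + c4 * zsum (fun k => Cim (g k)) N)).
- intros N. rewrite <- !zsum_scal, <- !zsum_plus. apply zsum_ext. intros k. symmetry. apply H.
- repeat apply CV_plus; (apply CV_mult; [apply Un_cv_const|]); assumption.
Qed.

(** * Integrals of exponentials over a period *)

Lemma RInt_antiderivative (f g : R -> R) A B :
  (forall x, derivable_pt_lim f x (g x)) -> (forall x, continuous g x) ->
  RInt g A B = f B - f A :> R.
Proof.
intros Hd Hc. apply (is_RInt_unique (V := R_CompleteNormedModule)).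
apply (is_RInt_derive (V := R_CompleteNormedModule) f g).
- intros x _. apply is_derive_Reals, Hd.
- intros x _. apply Hc.
Qed.

(** The argument is written [x * IZR m] so that the factor is convertible with the exponential in
    the theorem. *)
Definition expi (m : Z) (x : R) : CC := Cexp (Cscal (x * IZR m) Ci).

Lemma expi_eq m x : expi m x = (cos (IZR m * x), sin (IZR m * x)).
Proof.
unfold expi, Cexp, Cscal, Ci, Cre, Cim; simpl.
rewrite Rmult_0_r, exp_0, !Rmult_1_l, Rmult_1_r, (Rmult_comm x). reflexivity.
Qed.

Lemma expi_continuous m x : Ccontinuous (expi m) x.
Proof.
apply Cexp_continuous.
assert (H : continuous (fun t : R => t * IZR m) x).
{ apply continuous_Rmult; [apply continuous_id|apply continuous_const]. }
split; (apply continuous_Rmult; [exact H|apply continuous_const]).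
Qed.

Lemma expi_periodic m : Cperiodic (expi m).
Proof.
intros x k. rewrite !expi_eq.
replace (IZR m * (x + 2 * PI * IZR k)) with (IZR m * x + 2 * PI * IZR (m * k))
  by (rewrite mult_IZR; ring).
destruct (cos_sin_period_Z (IZR m * x) (m * k)) as [-> ->]. reflexivity.
Qed.

Lemma derivable_pt_lim_linear A x : derivable_pt_lim (fun y => A * y) x A.
Proof.
pose proof (derivable_pt_lim_scal id A x 1 (derivable_pt_lim_id x)) as H.
rewrite Rmult_1_r in H. exact H.
Qed.

(** The general real-linear form is what a real coordinate of a quaternion with both components
    [expi m x] becomes. *)
Lemma RInt_expi A B m :
  RInt (fun x => A * Cre (expi m x) + B * Cim (expi m x)) 0 (2 * PI)
  = (if Z.eqb m 0 then 2 * PI * A else 0) :> R.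
Proof.
assert (Hc : forall x, continuous (fun x => A * Cre (expi m x) + B * Cim (expi m x)) x).
{ intros x. destruct (expi_continuous m x) as [H1 H2].
  apply continuous_Rplus; (apply continuous_Rmult; [apply continuous_const|]); assumption. }
destruct (Z.eqb_spec m 0) as [->|Hm].
- rewrite (RInt_antiderivative (fun x => A * x)); [ring| |exact Hc].
  intros x. rewrite expi_eq. simpl. rewrite Rmult_0_l, cos_0, sin_0, Rmult_0_r, Rplus_0_r, Rmult_1_r.
  apply derivable_pt_lim_linear.
- assert (Hm' : IZR m <> 0) by (intros E; apply Hm, eq_IZR, E).
  rewrite (RInt_antiderivative
     (fun x => A / IZR m * sin (IZR m * x) + - (B / IZR m) * cos (IZR m * x))); [| |exact Hc].
  + destruct (cos_sin_period_Z 0 m) as [H1 H2].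
    replace (IZR m * (2 * PI)) with (0 + 2 * PI * IZR m) by ring.
    rewrite H1, H2, Rmult_0_r. ring.
  + intros x. rewrite expi_eq. simpl.
    assert (Hl : derivable_pt_lim (fun y => IZR m * y) x (IZR m)).
    { apply derivable_pt_lim_linear. }
    replace (A * cos (IZR m * x) + B * sin (IZR m * x))
      with (A / IZR m * (cos (IZR m * x) * IZR m)
         + - (B / IZR m) * (- sin (IZR m * x) * IZR m)) by (field; exact Hm').
    apply (derivable_pt_lim_plus (fun x => A / IZR m * sin (IZR m * x))
      (fun x => - (B / IZR m) * cos (IZR m * x))).
    * apply (derivable_pt_lim_scal (fun x => sin (IZR m * x))).
      apply (derivable_pt_lim_comp (fun y => IZR m * y) sin); [exact Hl|apply derivable_pt_lim_sin].
    * apply (derivable_pt_lim_scal (fun x => cos (IZR m * x))).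
      apply (derivable_pt_lim_comp (fun y => IZR m * y) cos); [exact Hl|apply derivable_pt_lim_cos].
Qed.

(** * Conjugation and the Hurwitz condition *)

Lemma Cconj_Cmul z w : Cconj (Cmul z w) = Cmul (Cconj z) (Cconj w).
Proof. apply CC_eq; unfold Cconj, Cmul; simpl; ring. Qed.

Lemma Cconj_Cadd z w : Cconj (Cadd z w) = Cadd (Cconj z) (Cconj w).
Proof. apply CC_eq; unfold Cconj, Cadd; simpl; ring. Qed.

Lemma Cconj_Cexp z : Cconj (Cexp z) = Cexp (Cconj z).
Proof. apply CC_eq; unfold Cconj, Cexp; simpl; rewrite ?cos_neg, ?sin_neg; ring. Qed.

(** [ln (a + INR k)] is real, so conjugating the exponent conjugates each term, and with it the
    limit. *)
Lemma is_hurwitz_conj w a z : is_hurwitz w a z -> is_hurwitz (Cconj w) a (Cconj z).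
Proof.
intros [H1 H2].
assert (E : forall k, hurwitz_term (Cconj w) a k = Cconj (hurwitz_term w a k)).
{ intros k. unfold hurwitz_term. rewrite Cconj_Cexp, Cconj_Cmul. f_equal.
  apply CC_eq; unfold Cconj, Copp, RtoC, Cmul; simpl; ring. }
split.
- apply (Un_cv_ext (sum_f_R0 (fun k => Cre (hurwitz_term w a k)))); [|exact H1].
  intros N. apply sum_eq. intros k _. rewrite E. reflexivity.
- apply (Un_cv_ext (fun N => -1 * sum_f_R0 (fun k => Cim (hurwitz_term w a k)) N)).
  + intros N. rewrite scal_sum. apply sum_eq. intros k _. rewrite E. simpl. ring.
  + replace (Cim (Cconj z)) with (-1 * Cim z) by (simpl; ring).
    apply CV_mult; [apply Un_cv_const|exact H2].
Qed.

(* Conjugation turns $e^{-i\pi\bar w}$ into $e^{i\pi w}$, so closedness of $R$ under conjugation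
   gives the nonvanishing condition in the sign produced by the branch of $\Xi^w$ on $\xi<0$. *)
Lemma admissible_R_neq0 Rs w : admissible_R Rs -> Rs w ->
  forall alpha, 0 < alpha < 1 -> forall z1 z2,
     is_hurwitz w alpha z1 -> is_hurwitz w (1 - alpha) z2 ->
     Cadd z1 (Cmul (Cexp (Cmul (Cscal PI Ci) w)) z2) <> C0.
Proof.
intros [_ [Hconj Hnz]] Hw alpha Ha z1 z2 H1 H2 E.
apply Hconj in Hw.
apply (Hnz _ Hw alpha Ha (Cconj z1) (Cconj z2)); try apply is_hurwitz_conj; trivial.
apply (f_equal Cconj) in E. rewrite Cconj_Cadd, Cconj_Cmul, Cconj_Cexp, Cconj_Cmul in E.
replace (Cscal (- PI) Ci) with (Cconj (Cscal PI Ci)).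
- rewrite E. apply CC_eq; unfold Cconj, C0; simpl; ring.
- apply CC_eq; unfold Cconj, Cscal, Ci; simpl; ring.
Qed.

Lemma Xipow_periodization_spec w : 1 < Cre w ->
  (forall alpha, 0 < alpha < 1 -> forall z1 z2,
     is_hurwitz w alpha z1 -> is_hurwitz w (1 - alpha) z2 ->
     Cadd z1 (Cmul (Cexp (Cmul (Cscal PI Ci) w)) z2) <> C0) ->
  exists P C, Cdecays (Cre w) C (Xipow w) /\ Cperiodization (Xipow w) P /\ Cperiodic P /\
    (forall x, Ccontinuous P x) /\ forall x, P x <> C0.
Proof.
intros Hw Hz. destruct (Xipow_decays w Hw) as [C HC].
destruct (Cperiodization_ex _ _ _ Hw HC) as [P HP].
pose proof (Cperiodization_periodic _ _ _ _ Hw HC HP) as Hper.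
exists P, C. repeat split; trivial; try apply HC; try apply HP.
- apply (Cperiodization_continuous _ _ _ _ _ Hw HC); [|exact HP].
  intros y. apply Xipow_continuous, Hw.
- apply (Cperiodization_continuous _ _ _ _ _ Hw HC); [|exact HP].
  intros y. apply Xipow_continuous, Hw.
- apply (Xipow_periodization_neq0 w); assumption.
Qed.

Lemma HRvnorm_pos q : HRvec_nonzero q -> 0 < HRvnorm q.
Proof.
intros H. apply sqrt_lt_R0.
destruct (Req_EM_T (hr1 q) 0) as [E1|E1]; [|nra].
destruct (Req_EM_T (hr2 q) 0) as [E2|E2]; [|nra].
destruct (Req_EM_T (hr3 q) 0) as [E3|E3]; [|nra].
exfalso. apply H. auto.
Qed.

Theorem theorem3 (Rs : CC -> Prop) (HR_adm : admissible_R Rs) (q : HR) (Hq : in_Q_R Rs q) :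
  exists (F Finv : R -> HC),
    (* F_q(xi) = sum_{k in Z} \hat{B_q}(xi + 2 pi k) *)
    (forall xi, HC_Zsum (fun k => Bhat q (xi + 2 * PI * IZR k)) (F xi)) /\
    (* F_q(xi) is invertible in H_C, with inverse Finv xi *)
    (forall xi, HCmul (F xi) (Finv xi) = HC1 /\ HCmul (Finv xi) (F xi) = HC1) /\
    (* \hat{L_q} = \hat{B_q} F_q^{-1} lies in L^1 and L^2 *)
    L1HC (fun xi => HCmul (Bhat q xi) (Finv xi)) /\
    L2HC (fun xi => HCmul (Bhat q xi) (Finv xi)) /\
    (* L_q(m) = (1/2pi) int \hat{L_q}(xi) e^{i xi m} dxi = delta_{m,0} *)
    (forall m : Z, exists I : HC,
       HC_improper_int
         (fun xi => HCcscal (Cexp (Cscal (xi * IZR m) Ci)) (HCmul (Bhat q xi) (Finv xi))) I /\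
       HCrscal (/ (2 * PI)) I = (if Z.eqb m 0 then HC1 else HC0)).
Proof.
destruct Hq as [Hv Hw]. pose proof (HRvnorm_pos q Hv) as Hnu.
set (nu := HRvnorm q) in *. set (a := hr0 q) in *.
(* Both components of [z^q] need an admissible exponent; the second is the conjugate of the
   first. *)
assert (Hw' : Rs (a, - nu)) by (apply (proj1 (proj2 HR_adm)) in Hw; exact Hw).
assert (Ha : 1 < a) by (apply (proj1 HR_adm) in Hw; exact Hw).
destruct (Xipow_periodization_spec (a, nu) Ha (admissible_R_neq0 Rs _ HR_adm Hw))
  as [P [CP [HdP [HP [HpP [HcP HnP]]]]]].
destruct (Xipow_periodization_spec (a, - nu) Ha (admissible_R_neq0 Rs _ HR_adm Hw'))
  as [M [CM [HdM [HM [HpM [HcM HnM]]]]]].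
simpl Cre in HdP, HdM.
set (n1 := hr1 q / nu). set (n2 := hr2 q / nu). set (n3 := hr3 q / nu).
assert (Hn : n1 * n1 + n2 * n2 + n3 * n3 = 1).
{ assert (E : nu * nu = hr1 q ^ 2 + hr2 q ^ 2 + hr3 q ^ 2) by (apply sqrt_sqrt; nra).
  unfold n1, n2, n3.
  replace (hr1 q / nu * (hr1 q / nu) + hr2 q / nu * (hr2 q / nu) + hr3 q / nu * (hr3 q / nu))
    with ((hr1 q ^ 2 + hr2 q ^ 2 + hr3 q ^ 2) / (nu * nu)) by (field; lra).
  rewrite <- E. field. lra. }
assert (HB : forall x, Bhat q x = HCsplit n1 n2 n3 (Xipow (a, nu) x) (Xipow (a, - nu) x)).
{ intros x. apply qpow_split. fold nu. lra. }
set (Finv := fun x => HCsplit n1 n2 n3 (Cinv (P x)) (Cinv (M x))).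
(* The exponential is grouped with the inverse: their product is one continuous periodic multiplier
   of [Xi^w], to which the decay and periodization results apply. *)
assert (HBF : forall m x, HCcscal (expi m x) (HCmul (Bhat q x) (Finv x)) =
   HCsplit n1 n2 n3 (Cmul (Cmul (expi m x) (Cinv (P x))) (Xipow (a, nu) x))
     (Cmul (Cmul (expi m x) (Cinv (M x))) (Xipow (a, - nu) x))).
{ intros m x. unfold Finv. rewrite HB, HCsplit_mul, HCsplit_cscal by exact Hn.
  f_equal; ring. }
assert (HkP : forall m, (forall x, Ccontinuous (fun x => Cmul (expi m x) (Cinv (P x))) x) /\
    Cperiodic (fun x => Cmul (expi m x) (Cinv (P x)))).
{ intros m. split.
  - intros x. apply Ccontinuous_mul; [apply expi_continuous|apply Ccontinuous_inv; auto].
  - intros x k. rewrite expi_periodic, HpP. reflexivity. }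
assert (HkM : forall m, (forall x, Ccontinuous (fun x => Cmul (expi m x) (Cinv (M x))) x) /\
    Cperiodic (fun x => Cmul (expi m x) (Cinv (M x)))).
{ intros m. split.
  - intros x. apply Ccontinuous_mul; [apply expi_continuous|apply Ccontinuous_inv; auto].
  - intros x k. rewrite expi_periodic, HpM. reflexivity. }
assert (Hcont : forall m c, In c HCproj ->
   forall x, continuous (fun x => c (HCcscal (expi m x) (HCmul (Bhat q x) (Finv x)))) x).
{ intros m c Hc x.
  apply (continuous_ext (fun x => c (HCsplit n1 n2 n3
      (Cmul (Cmul (expi m x) (Cinv (P x))) (Xipow (a, nu) x))
      (Cmul (Cmul (expi m x) (Cinv (M x))) (Xipow (a, - nu) x)))));
    [intros t; rewrite HBF; reflexivity|].
  apply (HCproj_split_continuous n1 n2 n3 c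
    (fun x => Cmul (Cmul (expi m x) (Cinv (P x))) (Xipow (a, nu) x))
    (fun x => Cmul (Cmul (expi m x) (Cinv (M x))) (Xipow (a, - nu) x)) Hc);
   intros y; apply Ccontinuous_mul;
   [apply HkP|apply Xipow_continuous, Ha|apply HkM|apply Xipow_continuous, Ha]. }
assert (Hdec : forall m c, In c HCproj -> exists D,
   decays a D (fun x => c (HCcscal (expi m x) (HCmul (Bhat q x) (Finv x))))).
{ intros m c Hc. destruct (HkP m) as [K1 K2]. destruct (HkM m) as [K3 K4].
  destruct (Cdecays_mul a CP (Xipow (a, nu)) _ HdP K1 K2) as [D1 HD1].
  destruct (Cdecays_mul a CM (Xipow (a, - nu)) _ HdM K3 K4) as [D2 HD2].
  destruct (HCproj_split_decays n1 n2 n3 c a D1 D2 _ _ Hc HD1 HD2) as [D HD].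
  exists D. intros x. rewrite HBF. apply HD. }
(* The case [m = 0] recovers the function without exponential, so the integrability claims reuse the
   continuity and decay already established for all [m]. *)
assert (Hexp0 : forall x, HCcscal (expi 0 x) (HCmul (Bhat q x) (Finv x))
    = HCmul (Bhat q x) (Finv x)).
{ intros x. rewrite HB. unfold Finv. rewrite HCsplit_mul, HCsplit_cscal by exact Hn.
  rewrite expi_eq, Rmult_0_l, cos_0, sin_0. change (1, 0) with C1. f_equal; ring. }
exists (fun x => HCsplit n1 n2 n3 (P x) (M x)), Finv.
split; [|split; [|split; [|split]]].
- intros xi c Hc.
  apply (Un_cv_ext (zsum (fun k => c (HCsplit n1 n2 n3 (Xipow (a, nu) (xi + 2 * PI * IZR k))
     (Xipow (a, - nu) (xi + 2 * PI * IZR k)))))).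
  (* The partial sums in [HC_Zsum] unfold to [zsum], so only the summands have to be compared. *)
  + intros N. apply sum_eq. intros i _. rewrite HB. reflexivity.
  + apply (HCproj_split_cv n1 n2 n3 c (fun k => Xipow (a, nu) (xi + 2 * PI * IZR k))
      (fun k => Xipow (a, - nu) (xi + 2 * PI * IZR k)) _ _ Hc (HP xi) (HM xi)).
- intros xi. unfold Finv. rewrite !HCsplit_mul by exact Hn.
  replace (Cmul (Cinv (P xi)) (P xi)) with (Cmul (P xi) (Cinv (P xi))) by ring.
  replace (Cmul (Cinv (M xi)) (M xi)) with (Cmul (M xi) (Cinv (M xi))) by ring.
  rewrite !Cmul_Cinv by auto. split; apply HCsplit_1.
- intros c Hc. destruct (Hdec 0%Z c Hc) as [D HD].
  replace (fun x => c (HCmul (Bhat q x) (Finv x)))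
    with (fun x => c (HCcscal (expi 0 x) (HCmul (Bhat q x) (Finv x))))
    by (apply functional_extensionality; intros x; rewrite Hexp0; reflexivity).
  apply (decays_L1 a D); [exact Ha|exact HD|apply Hcont, Hc].
- intros c Hc. destruct (Hdec 0%Z c Hc) as [D HD].
  replace (fun x => c (HCmul (Bhat q x) (Finv x)))
    with (fun x => c (HCcscal (expi 0 x) (HCmul (Bhat q x) (Finv x))))
    by (apply functional_extensionality; intros x; rewrite Hexp0; reflexivity).
  apply (decays_L2 a D); [exact Ha|exact HD|apply Hcont, Hc].
(* [d] is the integral of [e^(i m x)] over one period. Both components have the same one, so the
   value is a scalar quaternion. *)
- intros m. set (d := RtoC (if Z.eqb m 0 then 2 * PI else 0)).
  exists (HCsplit n1 n2 n3 d d). split.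
  + intros c Hc. destruct (Hdec m c Hc) as [D HD].
    destruct (HCproj_split n1 n2 n3 c Hc) as [c1 [c2 [c3 [c4 Hlin]]]].
    assert (EI : c (HCsplit n1 n2 n3 d d) =
      RInt (fun x => c (HCsplit n1 n2 n3 (expi m x) (expi m x))) 0 (2 * PI) :> R).
    { rewrite Hlin. symmetry.
      transitivity (RInt (fun x => (c1 + c3) * Cre (expi m x) + (c2 + c4) * Cim (expi m x))
        0 (2 * PI)).
      - apply RInt_ext. intros x _. rewrite Hlin.
        match goal with |- ?u = ?v => change (@eq R u v) end. ring.
      - rewrite RInt_expi. unfold d, RtoC. simpl. destruct (Z.eqb m 0); ring. }
    rewrite EI.
    apply (decays_improper_int a D _ _ Ha HD (Hcont m c Hc)).
    intros x.
    apply (Un_cv_ext (zsum (fun k => c (HCsplit n1 n2 n3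
       (Cmul (Cmul (expi m (x + 2 * PI * IZR k)) (Cinv (P (x + 2 * PI * IZR k))))
          (Xipow (a, nu) (x + 2 * PI * IZR k)))
       (Cmul (Cmul (expi m (x + 2 * PI * IZR k)) (Cinv (M (x + 2 * PI * IZR k))))
          (Xipow (a, - nu) (x + 2 * PI * IZR k))))))).
    * intros N. apply zsum_ext. intros k. rewrite HBF. reflexivity.
    (* The limit is put in the form multiplier times periodization, in which the periodization of a
       product delivers it. *)
    * assert (EP : forall f x, f x <> C0 -> expi m x = Cmul (Cmul (expi m x) (Cinv (f x))) (f x)).
      { intros f y Hf. transitivity (Cmul (expi m y) (Cmul (f y) (Cinv (f y)))); [|ring].
        rewrite Cmul_Cinv by exact Hf. ring. }
      replace (HCsplit n1 n2 n3 (expi m x) (expi m x)) with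
       (HCsplit n1 n2 n3 (Cmul (Cmul (expi m x) (Cinv (P x))) (P x))
         (Cmul (Cmul (expi m x) (Cinv (M x))) (M x))) by (rewrite <- !EP by auto; reflexivity).
      apply (HCproj_split_cv n1 n2 n3 c
        (fun k => Cmul (Cmul (expi m (x + 2 * PI * IZR k)) (Cinv (P (x + 2 * PI * IZR k))))
          (Xipow (a, nu) (x + 2 * PI * IZR k)))
        (fun k => Cmul (Cmul (expi m (x + 2 * PI * IZR k)) (Cinv (M (x + 2 * PI * IZR k))))
          (Xipow (a, - nu) (x + 2 * PI * IZR k)))); trivial.
      -- apply (Cperiodization_mul (Xipow (a, nu)) P _ HP (proj2 (HkP m))).
      -- apply (Cperiodization_mul (Xipow (a, - nu)) M _ HM (proj2 (HkM m))).
  + unfold HCrscal. rewrite HCsplit_cscal.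
    replace (Cmul (RtoC (/ (2 * PI))) d) with (if Z.eqb m 0 then C1 else C0).
    * destruct (Z.eqb m 0); [apply HCsplit_1|apply HCsplit_0].
    * pose proof PI_RGT_0. unfold d, RtoC. destruct (Z.eqb m 0); apply CC_eq;
        unfold Cmul, C0, C1; simpl; field; lra.
Qed.
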